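(* Let $G$ be an exceptional strongly regular graph with parameters $(v,k,\lambda,\mu)$. Then $k/\Lambda(G) > v^{1/10}/2$.
   Context: A graph is strongly regular with parameters $(v,k,\lambda,\mu)$ if it is a $k$-regular graph on $v$ vertices such that each edge lies in exactly $\lambda$ triangles and any two distinct non-adjacent vertices have exactly $\mu$ common neighbours; complete and edgeless graphs are excluded. For a $k$-regular graph $G$ on $v$ vertices with adjacency eigenvalues $k=\lambda_1\ge\lambda_2\ge\dots\ge\lambda_v$, set $\Lambda(G)=\max\{|\lambda_i| : 2\le i\le v\}$. A connected strongly regular graph is called exceptional if it is not one of the following: (i) a complete multipartite graph $K_{m,m,\dots,m}$ (all parts of equal size $m$); (ii) a Latin square graph: given $m-2$ mutually orthogonal Latin squares of order $n$ (with $m\ge 2$ allowed, $m=2$ meaning no squares), the vertices are the $n^2$ cells, and two cells are adjacent if they lie in the same row, or the same column, or have the same entry in one of the squares; (iii) a Steiner graph: the vertices are the blocks of a Steiner system $S(2,m,n)$ (a family of $m$-subsets of an $n$-set such that any two points lie in a unique block; $m=2$ allowed), two blocks being adjacent iff they intersect. *)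

(* Defs.v *)
From HB Require Import structures.
From mathcomp Require Import all_boot all_order all_algebra all_field.
Set Implicit Arguments. Unset Strict Implicit. Unset Printing Implicit Defensive.
Import Order.TTheory GRing.Theory Num.Theory.

Definition simple_graph (T : finType) (e : rel T) : Prop :=
  symmetric e /\ irreflexive e.

Definition nbhd (T : finType) (e : rel T) (x : T) : {set T} := [set y | e x y].

Definition common_nbrs (T : finType) (e : rel T) (x y : T) : nat :=
  #|nbhd e x :&: nbhd e y|.

Definition srg (T : finType) (e : rel T) (v k lam mu : nat) : Prop :=
  simple_graph e /\ #|T| = v /\
  (forall x, #|nbhd e x| = k) /\
  (forall x y, e x y -> common_nbrs e x y = lam) /\
  (forall x y, x != y -> ~~ e x y -> common_nbrs e x y = mu) /\
  (exists x y, e x y) /\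
  (exists x y, x != y /\ ~~ e x y).

Definition connected_graph (T : finType) (e : rel T) : Prop :=
  forall x y, connect e x y.

Definition graph_iso (T U : finType) (e : rel T) (f : rel U) : Prop :=
  exists g : T -> U, bijective g /\ forall x y, f (g x) (g y) = e x y.

(* (i) complete multipartite graph K_{m,...,m} with t parts of size m *)
Definition cmp_rel (t m : nat) : rel ('I_t * 'I_m) :=
  fun x y => x.1 != y.1.

Definition latin_square (n : nat) (L : 'I_n -> 'I_n -> 'I_n) : Prop :=
  (forall i, injective (L i)) /\ (forall j, injective (fun i => L i j)).

Definition orthogonal_ls (n : nat) (L1 L2 : 'I_n -> 'I_n -> 'I_n) : Prop :=
  forall i j i' j', L1 i j = L1 i' j' -> L2 i j = L2 i' j' -> i = i' /\ j = j'.

(* a family of r mutually orthogonal Latin squares of order n (r = m - 2) *)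
Definition mols (n r : nat) (L : 'I_r -> 'I_n -> 'I_n -> 'I_n) : Prop :=
  (forall s, latin_square (L s)) /\
  (forall s s', s != s' -> orthogonal_ls (L s) (L s')).

Definition latin_rel (n r : nat) (L : 'I_r -> 'I_n -> 'I_n -> 'I_n)
  : rel ('I_n * 'I_n) :=
  fun x y => (x != y) &&
    [|| x.1 == y.1, x.2 == y.2 | [exists s, L s x.1 x.2 == L s y.1 y.2]].

Definition steiner_system (n m : nat) (B : {set {set 'I_n}}) : Prop :=
  (forall X, X \in B -> #|X| = m) /\
  (forall p q : 'I_n, p != q -> exists! X, X \in B /\ p \in X /\ q \in X).

Definition block_type (n : nat) (B : {set {set 'I_n}}) : finType :=
  {X : {set 'I_n} | X \in B}.

Definition steiner_rel (n : nat) (B : {set {set 'I_n}}) : rel (block_type B) :=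
  fun X Y => (X != Y) && (val X :&: val Y != set0).

Definition exceptional (T : finType) (e : rel T) : Prop :=
  [/\ ~ (exists t m, graph_iso e (@cmp_rel t m)),
      ~ (exists n r (L : 'I_r -> 'I_n -> 'I_n -> 'I_n),
            mols L /\ graph_iso e (latin_rel L)) &
      ~ (exists n m (B : {set {set 'I_n}}),
            2 <= m /\ @steiner_system n m B /\ graph_iso e (@steiner_rel n B))]%N.

Definition adj_mx (T : finType) (e : rel T) : 'M[algC]_#|T| :=
  \matrix_(i, j) (e (enum_val i) (enum_val j))%:R%R.

(* Lambda(G) = max |lambda_i|, i >= 2, where s is the multiset of eigenvalues
   (roots of the characteristic polynomial with multiplicity) and one copy of
   lambda_1 = k is removed. *)
Definition Lambda (s : seq algC) (k : nat) : algC :=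
  (\big[Num.max/0]_(x <- rem (k%:R : algC) s) `|x|)%R.

(* Main.v *)
Require Import Defs.
From HB Require Import structures.
From mathcomp Require Import all_boot all_order all_algebra all_field.
From mathcomp Require Import zify ring.
Set Implicit Arguments. Unset Strict Implicit. Unset Printing Implicit Defensive.
Import Order.TTheory GRing.Theory Num.Theory.

(** Let k, r >= 0 and -m < 0 be the eigenvalues of G.  Then k = mu + r m,
    lambda = mu + r - m and v mu = (k - r)(k + m), and G is complete
    multipartite when r = 0.  If r, m are irrational, G is a conference graph
    and k / Lambda = sqrt v - 1.  Otherwise r and m are integers, and ranks of
    Hadamard products of the eigenprojections give v <= (f + 1)^2 for each of
    the two multiplicities f.

    Suppose (2k)^10 <= v Lambda^10.  If m > r, the bound on the multiplicity of
    -m is already contradictory.  If r >= m, then k / r > m gives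
    v >= (2m)^10, and the bound on the multiplicity of r gives r^2 <= v m^2;
    together with v mu <= k^2 these force r > 16 m^2 mu.  In this range the
    Bruck-Bose argument applies: the neighbourhood of a vertex contains no
    m + 1 pairwise non-adjacent vertices, every edge lies in exactly one large
    maximal clique, and every vertex in exactly m of them.  Writing N for the
    vertex-clique incidence matrix, N N^T = A + m I, so N^T kills the
    eigenvectors for -m; this makes all cliques of the same size and gives a
    constant number t = mu / m of neighbours of a vertex in a clique missing
    it.  If t = m the dual is a Steiner system, if t = m - 1 the cliques form a
    net, and if t <= m - 2 the integrality of f yields r <= m^4, so that
    v <= 4 m^10, a contradiction. *)

(** * Ranks, traces and diagonalizable matrices *)

Section LinearAlgebra.
Local Open Scope ring_scope.
Variable F : fieldType.

Lemma mxrank_sum_le m n (I : finType) (B : I -> 'M[F]_(m, n)) :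
  (\rank (\sum_i B i)%R <= \sum_i \rank (B i))%N.
Proof.
elim/big_ind2: _ => // [|A a B' b leA leB]; first by rewrite mxrank0.
exact: leq_trans (mxrank_add _ _) (leq_add leA leB).
Qed.

(** A full-rank factorization writes A as a sum of [\rank A] rank-one matrices. The Hadamard product
    of B with a rank-one matrix is B multiplied by a diagonal matrix on each side, so its rank is at
    most that of B. *)
Lemma mxrank_hadamard m n (A B : 'M[F]_(m, n)) :
  (\rank (map2_mx *%R A B) <= \rank A * \rank B)%N.
Proof.
have -> : map2_mx *%R A B = \sum_(p < \rank A)
    diag_mx (\row_i col_base A i p) *m B *m diag_mx (row p (row_base A)).
  apply/matrixP=> i j; rewrite !mxE summxE -{1}(mulmx_base A) mxE mulr_suml.
  by apply: eq_bigr => p _; rewrite mul_mx_diag mul_diag_mx !mxE mulrAC.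
apply: leq_trans (mxrank_sum_le _) _; rewrite -[\rank A in X in (_ <= X)%N]card_ord.
rewrite -sum_nat_const; apply: leq_sum => p _.
exact: leq_trans (mxrankM_maxl _ _) (mxrankM_maxr _ _).
Qed.

Lemma mulmx_full_free_scalar n g (X : 'M[F]_(n, g)) (Y : 'M[F]_(g, n)) t :
  row_full X -> row_free Y -> (X *m Y) *m (X *m Y) = t *: (X *m Y) ->
  Y *m X = t%:M.
Proof.
move=> /row_fullP[C CX] /row_freeP[D YD] XY.
have : C *m ((X *m Y) *m (X *m Y)) *m D = C *m (t *: (X *m Y)) *m D by rewrite XY.
rewrite -scalemxAr -scalemxAl !mulmxA CX mul1mx YD -!mulmxA YD mulmx1.
by rewrite scalemx1.
Qed.

(** If P = X Y is a full-rank factorization, then Y X is the scalar matrix t of size [\rank P], and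
    it has the same trace as X Y. *)
Lemma mxtrace_quasi_idempotent n (P : 'M[F]_n) (t : F) :
  P *m P = t *: P -> \tr P = t * (\rank P)%:R.
Proof.
move=> PP; rewrite -{1}(mulmx_base P) mxtrace_mulC.
rewrite (mulmx_full_free_scalar (col_base_full P) (row_base_free P) (t := t)).
  by rewrite mxtrace_scalar mulr_natr.
by rewrite mulmx_base.
Qed.

(** Unique factorization of the characteristic polynomial makes s a permutation of the diagonal of
    any diagonal form of A. *)
Lemma mxtrace_diagonalizable n (A : 'M[F]_n) (s : seq F) :
  diagonalizable A -> char_poly A = \prod_(x <- s) ('X - x%:P) ->
  \tr A = \sum_(x <- s) x /\ \tr (A *m A) = \sum_(x <- s) x ^+ 2.
Proof.
case=> P Pu /(similar_diagLR Pu)[d] defA chA.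
rewrite conjVmx // in defA.
have trC B : \tr (invmx P *m B *m P) = \tr B.
  by rewrite mxtrace_mulC mulmxA mulmxV // mul1mx.
have sd : perm_eq s [seq d 0 i | i <- enum 'I_n].
  apply: prod_XsubC_eq; rewrite -chA big_map big_enum /=.
  have -> : char_poly A = char_poly (diag_mx d).
    rewrite /char_poly.
    have -> : char_poly_mx A =
        map_mx polyC (invmx P) *m char_poly_mx (diag_mx d) *m map_mx polyC P.
      rewrite /char_poly_mx mulmxBr mulmxBl -!map_mxM -defA.
      by rewrite mul_mx_scalar -scalemxAl -map_mxM mulVmx // map_mx1 scalemx1.
    rewrite !det_mulmx mulrAC -det_mulmx -map_mxM mulVmx // map_mx1 det1.
    by rewrite mul1r.
  rewrite char_poly_trig ?diag_mx_is_trig //.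
  by apply: eq_bigr => i _; rewrite mxE eqxx.
split.
  rewrite (perm_big _ sd) big_map big_enum /= defA trC.
  by apply: eq_bigr => i _; rewrite mxE eqxx.
have -> : A *m A = invmx P *m (diag_mx d *m diag_mx d) *m P.
  by rewrite defA -!mulmxA (mulmxA P) mulmxV // mul1mx.
rewrite (perm_big _ sd) big_map big_enum /= trC mulmx_diag.
by apply: eq_bigr => i _; rewrite !mxE eqxx expr2.
Qed.

Definition mx_prod_XsubC n (A : 'M[F]_n) (rs : seq F) : 'M[F]_n :=
  foldr (fun x B => (A - x%:M) *m B) 1%:M rs.

Lemma diagonalizable_mx_prod_XsubC n (A : 'M[F]_n) (rs : seq F) :
  uniq rs -> mx_prod_XsubC A rs = 0 -> diagonalizable A.
Proof.
case: n A => [|n] A urs A0.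
  by exists 1%:M; rewrite ?unitmx1 //; apply/is_diag_mxP => -[].
apply/diagonalizableP; exists rs => //; apply: mxminpoly_min; rewrite -{}A0.
elim: rs {urs} => [|x rs IH]; first by rewrite big_nil rmorph1.
by rewrite big_cons rmorphM rmorphB /= horner_mx_X horner_mx_C IH.
Qed.

Lemma eigenvalue_mx_prod_XsubC n (A : 'M[F]_n) (rs : seq F) x :
  mx_prod_XsubC A rs = 0 -> eigenvalue A x -> x \in rs.
Proof.
move=> A0 /eigenvalueP[u uA u0].
have /eqP : u *m mx_prod_XsubC A rs = (\prod_(y <- rs) (x - y)) *: u.
  elim: rs {A0} => [|y rs IH] /=; first by rewrite big_nil mulmx1 scale1r.
  by rewrite mulmxA mulmxBr uA mul_mx_scalar -scalerBl -scalemxAl IH scalerA big_cons.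
rewrite A0 mulmx0 eq_sym scaler_eq0 (negPf u0) orbF prodf_seq_eq0.
by case/hasP=> y yrs; rewrite subr_eq0 => /eqP->.
Qed.

End LinearAlgebra.

(** * The algebra spanned by I, A and J *)

Section AdjacencyAlgebra.
Local Open Scope ring_scope.
Variables (T : finType) (e : rel T) (v k lam mu : nat).
Hypothesis G : srg e v k lam mu.

Let esym x y : e x y = e y x. Proof. by case: G => -[]. Qed.
Let eirr x : e x x = false. Proof. by case: G => -[]. Qed.
Let cardT : #|T| = v. Proof. by case: G => _ []. Qed.
Let deg x : #|nbhd e x| = k. Proof. by case: G => _ [_ []]. Qed.

Lemma srg_common x y : common_nbrs e x y =
  (k * (x == y) + lam * e x y + mu * ((x != y) && ~~ e x y))%N.
Proof.
case: G => _ [_ [_ [el [em _]]]].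
case: (eqVneq x y) => [<-|neq]; first by rewrite eirr /common_nbrs setIid deg; lia.
by case: (boolP (e x y)) => exy; rewrite ?(el _ _ exy) ?(em _ _ neq exy) /=; lia.
Qed.

Lemma common_nbrs_sum x y : common_nbrs e x y = (\sum_z (e x z && e z y))%N.
Proof.
rewrite -big_mkcond /= sum1dep_card /common_nbrs; apply: eq_card => z.
by rewrite !inE (esym y).
Qed.

Lemma deg_sum x : (\sum_z e x z)%N = k.
Proof.
by rewrite -big_mkcond /= sum1dep_card -(deg x); apply: eq_card => z; rewrite !inE.
Qed.

(** Walks of length two from a vertex, counted by midpoint and by endpoint. This is k (k - lam - 1)
    = mu (v - k - 1) without subtractions. *)
Lemma srg_count : (k * k + mu * k.+1 = k + lam * k + mu * v)%N.
Proof.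
case: G => _ [_ [_ [_ [_ [[x _] _]]]]].
have H : (\sum_y common_nbrs e x y = k * k)%N.
  under eq_bigr do rewrite common_nbrs_sum.
  rewrite exchange_big /=.
  rewrite -{1}(deg_sum x) big_distrl /=; apply: eq_bigr => z _.
  under eq_bigr do rewrite -mulnb; by rewrite -big_distrr /= deg_sum.
have S1 : (\sum_y (x == y) = 1)%N.
  by rewrite (bigD1 x) //= eqxx big1 // => y; rewrite eq_sym => /negPf->.
have S3 : (\sum_y ((x != y) && ~~ e x y) + k + 1 = v)%N.
  rewrite -(deg_sum x) -S1 -cardT -!big_split -sum1_card; apply: eq_bigr => y _ /=.
  by case: eqVneq => [<-|]; rewrite ?eirr //; case: (e x y).
rewrite -H; under eq_bigr do rewrite srg_common.
rewrite !big_split -!big_distrr /= S1 deg_sum -S3; lia.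
Qed.

Local Notation A := (adj_mx e).
Local Notation J := (const_mx 1 : 'M[algC]_#|T|).

Lemma sum_enum_val (F : T -> algC) : \sum_(i < #|T|) F (enum_val i) = \sum_x F x.
Proof. by rewrite (big_enum_val F). Qed.

Lemma adj_mxM : A *m A = (k%:R - mu%:R)%:M + (lam%:R - mu%:R) *: A + mu%:R *: J.
Proof.
apply/matrixP => i j; rewrite !mxE.
transitivity ((common_nbrs e (enum_val i) (enum_val j))%:R : algC).
  rewrite common_nbrs_sum natr_sum -sum_enum_val; apply: eq_bigr => l _.
  by rewrite !mxE -natrM mulnb.
rewrite srg_common (inj_eq enum_val_inj) !natrD !natrM.
case: (eqVneq i j) => [<-|neq]; rewrite ?eirr /=; first ring.
by case: (e _ _) => /=; ring.
Qed.

Lemma adj_mxJ : A *m J = k%:R *: J.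
Proof.
apply/matrixP => i j; rewrite !mxE.
under eq_bigr do rewrite !mxE mulr1.
by rewrite (sum_enum_val (fun x => (e (enum_val i) x)%:R)) -natr_sum deg_sum mulr1.
Qed.

Lemma mxJ_adj : J *m A = k%:R *: J.
Proof.
apply/matrixP => i j; rewrite !mxE.
under eq_bigr do rewrite !mxE mul1r esym.
by rewrite (sum_enum_val (fun x => (e (enum_val j) x)%:R)) -natr_sum deg_sum mulr1.
Qed.

Lemma mxJ_J : J *m J = v%:R *: J.
Proof.
apply/matrixP => i j; rewrite !mxE.
under eq_bigr do rewrite !mxE mulr1.
by rewrite sumr_const card_ord cardT mulr1.
Qed.

Lemma adj_mx_tr : \tr A = 0.
Proof. by rewrite /mxtrace big1 // => i _; rewrite mxE eirr. Qed.

Lemma mxJ_tr : \tr J = v%:R.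
Proof.
rewrite /mxtrace; under eq_bigr do rewrite mxE.
by rewrite sumr_const card_ord cardT.
Qed.

(** With this multiplication table, later matrix identities reduce to comparing three
    coefficients. *)
Lemma bose_mesnerM (a b c a' b' c' : algC) :
  (a%:M + b *: A + c *: J) *m (a'%:M + b' *: A + c' *: J) =
  (a * a' + b * b' * (k%:R - mu%:R))%:M
  + (a * b' + a' * b + b * b' * (lam%:R - mu%:R)) *: A
  + (a * c' + a' * c + (b * c' + b' * c) * k%:R + c * c' * v%:R
     + b * b' * mu%:R) *: J.
Proof.
rewrite !mulmxDl !mulmxDr -!scalemxAl -!scalemxAr adj_mxM adj_mxJ mxJ_adj mxJ_J.
rewrite !mul_mx_scalar !mul_scalar_mx.
by apply/matrixP => i j; rewrite !mxE; case: (i == j); rewrite ?mulr1n ?mulr0n; ring.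
Qed.

Lemma bose_mesner_tr (a b c : algC) :
  \tr (a%:M + b *: A + c *: J) = v%:R * (a + c).
Proof.
rewrite !mxtraceD !mxtraceZ mxtrace_scalar adj_mx_tr mxJ_tr cardT -mulr_natr; ring.
Qed.

(* The Hadamard product (M - c)(M - c - b) is the nonzero scalar matrix with
   diagonal a(a - b), so two factors of rank at most rank M + 1 suffice. *)
Lemma weak_absolute_bound (a b c : algC) : a != 0 -> a != b ->
  (v <= (\rank (a%:M + b *: A + c *: J)%R).+1 ^ 2)%N.
Proof.
move=> a0 ab; set M := (a%:M + _ + _)%R.
have rkC (d : algC) : (\rank (M - d *: J)%R <= (\rank M).+1)%N.
  rewrite -addn1; apply: leq_trans (mxrank_add _ _) _; rewrite leq_add2l mxrank_opp.
  apply: leq_trans (mxrank_scale _ _) _.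
  have -> : J = (const_mx 1 : 'cV_#|T|) *m (const_mx 1 : 'rV_#|T|).
    by apply/matrixP => i j; rewrite !mxE big_ord1 !mxE mulr1.
  exact: leq_trans (mxrankM_maxl _ _) (rank_leq_col _).
have H : map2_mx *%R (M - c *: J) (M - (c + b) *: J) = (a * (a - b))%:M.
  apply/matrixP => i j; rewrite !mxE.
  case: (eqVneq i j) => [<-|neq]; rewrite ?eirr ?mulr1n ?mulr0n /=; first ring.
  by case: (e _ _) => /=; ring.
have rk : \rank ((a * (a - b))%:M : 'M[algC]_#|T|) = v.
  rewrite -cardT -[RHS](mxrank1 algC) -scalemx1 mxrank_scale_nz //.
  by rewrite mulf_neq0 // subr_eq0.
by rewrite -rk -H (leq_trans (mxrank_hadamard _ _)) // -mulnn leq_mul.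
Qed.

End AdjacencyAlgebra.

(** * Eigenvalues, multiplicities and Lambda *)

Section Spectrum.
Local Open Scope ring_scope.
Variables (T : finType) (e : rel T) (v k lam mu : nat).
Hypothesis G : srg e v k lam mu.
Hypothesis mu_gt0 : (0 < mu)%N.
Variables r m : algC.
Hypotheses (r_gt0 : 0 < r) (m_gt0 : 0 < m).
Hypothesis k_eq : k%:R = mu%:R + r * m.
Hypothesis lam_eq : lam%:R + m = mu%:R + r.

Local Notation A := (adj_mx e).
Local Notation J := (const_mx 1 : 'M[algC]_#|T|).

Let v_gt0 : (0 < v)%N.
Proof. by case: G => _ [<- [_ [_ [_ [[x _] _]]]]]; apply/card_gt0P; exists x. Qed.

Let v_neq0 : v%:R != 0 :> algC. Proof. by rewrite pnatr_eq0 -lt0n. Qed.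

(** In matrix terms, these are the row sums of mu J = (A - r)(A + m). *)
Lemma srg_vmu : v%:R * mu%:R = (k%:R - r) * (k%:R + m) :> algC.
Proof.
have /(congr1 (fun n : nat => n%:R : algC)) := srg_count G.
rewrite -addn1 !natrD !natrM !natrD => H.
have lamE : lam%:R = mu%:R + r - m :> algC by rewrite -lam_eq addrK.
have rmE : r * m = k%:R - mu%:R by rewrite k_eq; ring.
have -> : v%:R * mu%:R =
    k%:R * k%:R + mu%:R * (k%:R + 1) - k%:R - (mu%:R + r - m) * k%:R :> algC.
  by rewrite H lamE; ring.
ring: rmE.
Qed.

(** The matrix A + m - ((k + m) / v) J is r + m times the projection onto the eigenspace of r, so f
    is the multiplicity of r. Its trace gives the equation. The condition m != 1 makes the
    coefficients of I and A differ, as [weak_absolute_bound] asks. *)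
Lemma rank_pos_eigenspace : m != 1 -> exists f : nat,
  f%:R * (r + m) = v%:R * m - k%:R - m /\ (v <= f.+1 ^ 2)%N.
Proof.
move=> m1; pose c : algC := - ((k%:R + m) / v%:R).
have cv : c * v%:R = - (k%:R + m) by rewrite mulNr divfK.
exists (\rank (m%:M + 1 *: A + c *: J)%R); split; last first.
  by apply: (weak_absolute_bound G) => //; rewrite gt_eqF.
rewrite mulrC -mxtrace_quasi_idempotent ?(bose_mesner_tr G).
  by ring: cv.
rewrite (bose_mesnerM G) !scalerDr !scalerA scale_scalar_mx.
have lamE : lam%:R = mu%:R + r - m :> algC by rewrite -lam_eq addrK.
have rmE : r * m = k%:R - mu%:R by rewrite k_eq; ring.
have vmu := srg_vmu.
congr (_%:M + _ *: _ + _ *: _); first by ring: rmE.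
  by ring: lamE.
apply: (mulIf v_neq0); rewrite -[RHS]mulrA cv.
transitivity (2 * (m + k%:R) * (c * v%:R) + (c * v%:R) ^+ 2 + v%:R * mu%:R).
  by ring.
by rewrite cv vmu; ring.
Qed.

(** Likewise, A - r - ((k - r) / v) J is -(r + m) times the projection onto the eigenspace of -m.
    The coefficients -r < 0 and 1 always differ. *)
Lemma rank_neg_eigenspace : exists g : nat,
  g%:R * (r + m) = v%:R * r + k%:R - r /\ (v <= g.+1 ^ 2)%N.
Proof.
pose c : algC := - ((k%:R - r) / v%:R).
have cv : c * v%:R = - (k%:R - r) by rewrite mulNr divfK.
exists (\rank ((- r)%:M + 1 *: A + c *: J)%R); split; last first.
  apply: (weak_absolute_bound G) => //; first by rewrite oppr_eq0 gt_eqF.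
  by rewrite lt_eqF // (lt_trans _ ltr01) // oppr_lt0.
apply: oppr_inj; rewrite mulrC -mulNr -mxtrace_quasi_idempotent ?(bose_mesner_tr G).
  by ring: cv.
rewrite (bose_mesnerM G) !scalerDr !scalerA scale_scalar_mx.
have lamE : lam%:R = mu%:R + r - m :> algC by rewrite -lam_eq addrK.
have rmE : r * m = k%:R - mu%:R by rewrite k_eq; ring.
have vmu := srg_vmu.
congr (_%:M + _ *: _ + _ *: _); first by ring: rmE.
  by ring: lamE.
apply: (mulIf v_neq0); rewrite -[RHS]mulrA cv.
transitivity (2 * (k%:R - r) * (c * v%:R) + (c * v%:R) ^+ 2 + v%:R * mu%:R).
  by ring.
by rewrite cv vmu; ring.
Qed.

Lemma k_gt_r : r < k%:R.
Proof.
have : 0 < v%:R * mu%:R :> algC by rewrite mulr_gt0 ?ltr0n.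
rewrite srg_vmu pmulr_lgt0 ?subr_gt0 //.
by rewrite addr_gt0 // k_eq addr_gt0 ?ltr0n ?mulr_gt0.
Qed.

Lemma adj_mx_prod : mx_prod_XsubC A [:: k%:R; r; - m] = 0.
Proof.
have lamE : lam%:R = mu%:R + r - m :> algC by rewrite -lam_eq addrK.
have rmE : r * m = k%:R - mu%:R by rewrite k_eq; ring.
rewrite /mx_prod_XsubC /= mulmx1.
have E x : A - x%:M = (- x)%:M + 1 *: A + 0 *: J.
  by rewrite scale1r scale0r addr0 addrC raddfN.
rewrite !E !(bose_mesnerM G).
set a := (X in X%:M + _ + _); set b := (X in _ + X *: _ + _).
set c := (X in _ + X *: _).
have [-> -> ->] : [/\ a = 0, b = 0 & c = 0].
  by split; rewrite /a /b /c lamE k_eq; ring.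
by rewrite raddf0 !scale0r !addr0.
Qed.

Variable s : seq algC.
Hypothesis char_s : char_poly A = \prod_(x <- s) ('X - x%:P).

Let negm_lt0 : - m < 0. Proof. by rewrite oppr_lt0. Qed.
Let k_gt0 : 0 < k%:R :> algC. Proof. exact: lt_trans r_gt0 k_gt_r. Qed.

Lemma spectrum_sub x : x \in s -> x \in [:: k%:R; r; - m].
Proof.
move=> xs; apply: eigenvalue_mx_prod_XsubC adj_mx_prod _.
by rewrite eigenvalue_root_char char_s root_prod_XsubC.
Qed.

Lemma spectrum_size : size s = v.
Proof.
have := size_char_poly A; rewrite char_s size_prod_XsubC => -[->].
by case: G => _ [].
Qed.

(* Evaluate the trace of (A - r)(A + m) = mu J on both sides. *)
Lemma count_k_spectrum : count_mem (k%:R : algC) s = 1%N.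
Proof.
have u3 : uniq [:: k%:R; r; - m].
  rewrite /= !inE negb_or !(gt_eqF k_gt_r) ?(gt_eqF (lt_trans negm_lt0 _)) //.
have [tr1 tr2] := mxtrace_diagonalizable
  (diagonalizable_mx_prod_XsubC u3 adj_mx_prod) char_s.
have : \sum_(x <- s) (x - r) * (x + m) = (count_mem (k%:R : algC) s)%:R * (v%:R * mu%:R).
  rewrite srg_vmu -sum1_count natr_sum big_distrl /= [RHS]big_mkcond /=.
  rewrite [LHS]big_seq [RHS]big_seq; apply: eq_bigr => x /spectrum_sub.
  rewrite !inE => /or3P[] /eqP->.
  - by rewrite eqxx mul1r.
  - by rewrite subrr mul0r lt_eqF // k_gt_r.
  - by rewrite addNr mulr0 lt_eqF // (lt_trans negm_lt0).
have -> : \sum_(x <- s) (x - r) * (x + m) =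
    \sum_(x <- s) x ^+ 2 + (m - r) * \sum_(x <- s) x - r * m * (size s)%:R.
  rewrite -sum1_size natr_sum !big_distrr -sumrN -!big_split /=.
  by apply: eq_bigr => x _; ring.
rewrite -tr1 -tr2 spectrum_size (adj_mx_tr G) (adj_mxM G) (bose_mesner_tr G) => H.
have /mulIf inj : v%:R * mu%:R != 0 :> algC.
  by rewrite mulf_neq0 // pnatr_eq0 -lt0n.
apply/eqP; rewrite -(eqr_nat algC); apply/eqP/inj; rewrite -H k_eq; ring.
Qed.

(** The eigenvalue k is simple, so removing one copy removes it altogether. *)
Lemma rem_spectrum x : x \in rem (k%:R : algC) s -> x = r \/ x = - m.
Proof.
move=> xs; have := spectrum_sub (mem_rem xs); rewrite !inE => /or3P[]/eqP xE;
  [|by left|by right].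
have := count_k_spectrum; have := xs; rewrite xE -has_pred1 has_count.
by rewrite count_rem /= eqxx => + E; rewrite -has_pred1 has_count E.
Qed.

Lemma bigmax_norm (t : seq algC) (M : algC) :
  0 <= M -> (forall x, x \in t -> `|x| <= M) ->
  0 <= \big[Num.max/0]_(x <- t) `|x| <= M.
Proof.
move=> M0 tM; rewrite big_seq; elim/big_ind: _ => [|x y|x /tM ->]; rewrite ?lexx //.
  by rewrite /Num.max; case: ifP.
by rewrite normr_ge0.
Qed.

Lemma bigmax_norm_gt0 (t : seq algC) :
  t != [::] -> (forall x, x \in t -> x != 0) -> 0 < \big[Num.max/0]_(x <- t) `|x|.
Proof.
case: t => // x t _ nz; rewrite big_cons /Num.max; case: ifP => [|_].
  exact: le_lt_trans.
by rewrite normr_gt0 nz // mem_head.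
Qed.

(** Positivity allows division by Lambda; it uses 1 < v, which leaves an eigenvalue after k is
    removed. *)
Lemma Lambda_bounds M : r <= M -> m <= M -> (1 < v)%N -> 0 < Lambda s k <= M.
Proof.
move=> rM mM v1; have M0 : 0 <= M by rewrite (le_trans _ rM) // ltW.
apply/andP; split.
  apply: bigmax_norm_gt0 => [|x /rem_spectrum[]->]; last 2 first.
  - by rewrite gt_eqF.
  - by rewrite oppr_eq0 gt_eqF.
  have ks : k%:R \in s by rewrite -has_pred1 has_count count_k_spectrum.
  by rewrite -size_eq0 size_rem // spectrum_size -lt0n; case: (v) v1 => [|[]].
suff /andP[] : 0 <= Lambda s k <= M by [].
apply: bigmax_norm => // x /rem_spectrum[]->;
  by rewrite ?normrN gtr0_norm.
Qed.

End Spectrum.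

(** * Claws and grand cliques, after Bruck and Bose *)

Section Claws.
Variables (T : finType) (e : rel T) (v k lam mu : nat).
Hypothesis G : srg e v k lam mu.

Let esym x y : e x y = e y x. Proof. by case: G => -[]. Qed.
Let eirr x : e x x = false. Proof. by case: G => -[]. Qed.
Let deg x : #|nbhd e x| = k. Proof. by case: G => _ [_ []]. Qed.

(** For y adjacent to x, this is the closed neighbourhood of y in the graph induced on the
    neighbours of x. *)
Definition closed_link x y : {set T} := y |: (nbhd e x :&: nbhd e y).

Lemma closed_link_sub x y : y \in nbhd e x -> closed_link x y \subset nbhd e x.
Proof. by move=> xy; rewrite subUset sub1set xy subsetIl. Qed.

Lemma card_closed_link x y : y \in nbhd e x -> #|closed_link x y| = lam.+1.
Proof.
rewrite inE => exy; rewrite cardsU1 !inE eirr andbF add1n; congr _.+1.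
by case: G => _ [_ [_ [el _]]]; rewrite -(el _ _ exy).
Qed.

(** Neither y nor z lies in the closed link of the other, so the intersection consists of common
    neighbours of y and z. *)
Lemma card_closed_linkI x y z : y != z -> ~~ e y z ->
  #|closed_link x y :&: closed_link x z| <= mu.
Proof.
move=> yz eyz; case: G => _ [_ [_ [_ [em _]]]]; rewrite -(em _ _ yz eyz).
apply/subset_leq_card/subsetP => w; rewrite !inE.
case: (eqVneq w y) => [->|_] /=; first by rewrite (negPf yz) (esym z) (negPf eyz) andbF.
case: (eqVneq w z) => [->|_] /=; first by rewrite (negPf eyz) andbF.
by case/and3P=> /andP[_ ->].
Qed.

Definition independent (S : {set T}) := [forall y in S, forall z in S, ~~ e y z].

Lemma independentP (S : {set T}) :
  reflect {in S &, forall y z, ~~ e y z} (independent S).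
Proof.
apply: (iffP forall_inP) => H y => [z yS zS|yS]; first exact: (forall_inP (H y yS)).
by apply/forall_inP => z zS; apply: H.
Qed.

(* Second Bonferroni inequality for the closed links of the elements of S. *)
Lemma claw_bound x (S : {set T}) : S \subset nbhd e x -> independent S ->
  #|S| * lam.+1 <= k + #|S| * #|S|.-1 * mu.
Proof.
move=> /subsetP Sx /independentP Si.
pose d z := \sum_(y in S) (z \in closed_link x y).
have cardE (B : {set T}) : #|B| = \sum_z (z \in B).
  by rewrite -big_mkcond /= sum1_card.
have d1 : \sum_z d z = #|S| * lam.+1.
  rewrite exchange_big -sum_nat_const; apply: eq_bigr => y yS.
  by rewrite -cardE card_closed_link ?Sx.
have d2 : \sum_z d z * d z <= #|S| * (lam.+1 + #|S|.-1 * mu).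
  under eq_bigr do rewrite big_distrlr /=.
  rewrite exchange_big /= -sum_nat_const; apply: leq_sum => y yS.
  rewrite exchange_big /= (bigD1 y) //= leq_add //.
    rewrite -(card_closed_link (Sx _ yS)) cardE leq_eqVlt; apply/orP; left.
    by apply/eqP/eq_bigr => z _; rewrite mulnb andbb.
  have -> : #|S|.-1 = #|[pred z in S | z != y]|.
    by rewrite (cardsD1 y S) yS /=; apply: eq_card => z; rewrite !inE andbC.
  rewrite -sum_nat_const; apply: leq_sum => z /andP[zS zy].
  have -> : \sum_w (w \in closed_link x y) * (w \in closed_link x z)
     = #|closed_link x y :&: closed_link x z|.
    by rewrite cardE; apply: eq_bigr => w _; rewrite in_setI mulnb.
  by rewrite card_closed_linkI ?Si // eq_sym.
(* Pointwise, 2 d <= 1 + d^2 on the neighbours of x, and d vanishes elsewhere. *)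
have d3 : \sum_z 2 * d z <= \sum_z ((z \in nbhd e x) + d z * d z).
  apply: leq_sum => z _; case: (boolP (z \in nbhd e x)) => zx.
    by rewrite (_ : nat_of_bool true = 1) //; nia.
  suff -> : d z = 0 by [].
  rewrite /d big1 // => y yS; apply/eqP; rewrite eqb0; apply: contra zx.
  by apply/subsetP/closed_link_sub/Sx.
by move: d3; rewrite -big_distrr big_split /= d1 -cardE deg; lia.
Qed.

Definition clique (C : {set T}) := [forall a in C, forall b in C, (a != b) ==> e a b].

Lemma cliqueP (C : {set T}) :
  reflect {in C &, forall a b, a != b -> e a b} (clique C).
Proof.
apply: (iffP forall_inP) => H a => [b aC bC|aC].
  by have /forall_inP/(_ b bC)/implyP := H a aC.
by apply/forall_inP => b bC; apply/implyP/H.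
Qed.

Lemma card_clique_le (C : {set T}) x y :
  clique C -> x \in C -> y \in C -> x != y -> #|C| <= lam.+2.
Proof.
move=> /cliqueP Cc xC yC xy; case: G => _ [_ [_ [el _]]].
rewrite (cardsD1 x) xC (cardsD1 y) !inE eq_sym xy yC !add1n !ltnS.
rewrite -(el _ _ (Cc _ _ xC yC xy)); apply/subset_leq_card/subsetP => z.
by rewrite !inE => /and3P[zy zx zC]; rewrite !Cc // eq_sym.
Qed.

Variables r m : nat.
Hypotheses (k_eq : k = mu + r * m) (lam_eq : lam + m = mu + r).
Hypotheses (m_gt1 : 1 < m) (mu_gt0 : 0 < mu) (r_big : 16 * (m * m * mu) <= r).

(** Comparing the monomials with m^2 mu turns the later estimates into linear ones. *)
Let mono : [/\ m * m <= m * m * mu, 4 * mu <= m * m * mu, 2 * (m * mu) <= m * m * mu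
   & m <= m * mu].
Proof.
have mm : 4 <= m * m by rewrite (@leq_mul 2 2).
by split; rewrite ?leq_pmulr // ?mulnA leq_mul ?leq_mul.
Qed.

(** For m + 1 vertices the left side of [claw_bound] is about (m + 1) r and the right side about m
    r, which a large r forbids. *)
Lemma card_independent_le x (S : {set T}) :
  S \subset nbhd e x -> independent S -> #|S| <= m.
Proof.
move=> Sx Si; rewrite leqNgt; apply/negP => mS.
have [S' S'S cS'] : exists2 S' : {set T}, S' \subset S & #|S'| = m.+1.
  exists [set z in take m.+1 (enum S)].
    by apply/subsetP => z; rewrite inE => /mem_take; rewrite mem_enum.
  rewrite cardsE (card_uniqP _) ?take_uniq ?enum_uniq //.
  by rewrite size_takel // -cardE.
have S'i : independent S'.
  by apply/independentP => a b aS bS; apply: (independentP _ Si); apply: (subsetP S'S).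
have := claw_bound (subset_trans S'S Sx) S'i; rewrite cS' k_eq /=.
have -> : lam = mu + r - m by lia.
have : m * m <= m * r by nia.
case: mono; lia.
Qed.

(** Consequently m - 1 closed links cannot cover the neighbourhood of a vertex. *)
Lemma k_large : ~~ (k <= m.-1 * lam.+1).
Proof.
rewrite k_eq; have -> : lam = mu + r - m by lia.
move: mono r_big m_gt1; case: (m) => [|[|q]] // [? ? ? ?] ? _ /=; apply/negP; nia.
Qed.

Lemma card_bigcup_closed_link x (S : {set T}) : S \subset nbhd e x ->
  #|\bigcup_(s in S) closed_link x s| <= #|S| * lam.+1.
Proof.
move=> Sx; rewrite -sum_nat_const.
elim/big_rec2: _ => [|s B U sS IH]; first by rewrite cards0.
apply: leq_trans (leq_card_setU _ _) _; rewrite leq_add //.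
by rewrite card_closed_link // (subsetP Sx).
Qed.

(** The closed links of a maximal independent set cover the neighbourhood of x, so by [k_large] such
    a set has at least m elements. *)
Lemma independent_extend x y : y \in nbhd e x ->
  exists S : {set T}, [/\ y \in S, S \subset nbhd e x, independent S & #|S| = m].
Proof.
move=> xy; pose P (S : {set T}) := (S \subset nbhd e x) && independent S.
have /maxset_exists[S /maxsetP[/andP[Sx Si] Smax]] : P [set y].
  rewrite /P sub1set xy; apply/independentP => a b /set1P-> /set1P->.
  by rewrite eirr.
rewrite sub1set => yS; exists S; split => //.
apply/eqP; rewrite eqn_leq (card_independent_le Sx) //=.
rewrite leqNgt; apply/negP => cS.
have : nbhd e x \subset \bigcup_(s in S) closed_link x s.
  apply/subsetP => z zx; apply/negPn/negP => zU.
  have zS s : s \in S -> (z != s) && ~~ e s z.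
    move=> sS; rewrite -negb_or; apply: contra zU => zs.
    by apply/bigcupP; exists s; rewrite // !inE; move: zx; rewrite inE => ->.
  have : P (z |: S).
    rewrite /P subUset sub1set zx Sx /=.
    apply/independentP => a b /setU1P[->|aS] /setU1P[->|bS].
    - by rewrite eirr.
    - by rewrite esym; case/andP: (zS b bS).
    - by case/andP: (zS a aS).
    - exact: (independentP _ Si).
  move=> /Smax/(_ (subsetUr _ _)) E.
  by have := setU11 z S; rewrite E => /zS; rewrite eqxx.
move/subset_leq_card; rewrite deg.
suff : #|\bigcup_(s in S) closed_link x s| <= #|S| * lam.+1.
  move=> H1 H2; have : k <= m.-1 * lam.+1.
    apply: leq_trans H2 (leq_trans H1 _); rewrite leq_mul2r; lia.
  exact/negP/k_large.
exact: card_bigcup_closed_link.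
Qed.

(** Extend y to an independent m-set S. The neighbours of x outside the closed links of the other m
    - 1 elements of S form, together with x, the required clique; its size is bounded below through
    k - (m - 1)(lam + 1). *)
Lemma large_clique x y : e x y ->
  exists C : {set T}, [/\ clique C, x \in C, y \in C & r < #|C| + m * mu].
Proof.
move=> exy; have xy : y \in nbhd e x by rewrite inE.
have [S [yS Sx Si cS]] := independent_extend xy.
pose K := nbhd e x :\: \bigcup_(s in S :\ y) closed_link x s.
have KP z : z \in K -> e x z /\ (forall s, s \in S -> s != y -> z != s /\ ~~ e s z).
  rewrite in_setD => /andP[zU zx]; split=> [|s sS sy]; first by rewrite inE in zx.
  apply/andP; rewrite -negb_or; apply: contra zU => zs.
  apply/bigcupP; exists s; rewrite !inE ?sy //.
  by move: zx; rewrite inE => ->.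
have yK : y \in K.
  rewrite in_setD xy andbT; apply/bigcupP => -[s]; rewrite !inE => /andP[sy sS].
  rewrite eq_sym (negPf sy) exy /=.
  exact/negP/(independentP _ Si).
have cK : k <= #|K| + m.-1 * lam.+1.
  rewrite -(deg x) -(cardsID (\bigcup_(s in S :\ y) closed_link x s)) addnC leq_add2l.
  have -> : m.-1 = #|S :\ y| by rewrite -cS (cardsD1 y S) yS.
  apply: leq_trans (card_bigcup_closed_link _) => //.
    by apply/subset_leq_card/subsetIr.
  exact: subset_trans (subsetDl _ _) Sx.
exists (x |: K); split; rewrite ?setU11 ?setU1r //; last first.
  rewrite cardsU1 in_setD [x \in nbhd _ _]inE eirr andbF add1n.
  rewrite addSn ltnS; move: cK; rewrite k_eq.
  have -> : lam = mu + r - m by lia.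
  move: mono r_big m_gt1; case: (m) => [|[|q]] // [? ? ? ?] ? _ /=; nia.
apply/cliqueP => a b /setU1P[->|aK] /setU1P[->|bK]; rewrite ?eqxx // => ab.
- by case: (KP _ bK).
- by rewrite esym; case: (KP _ aK).
have [[xa aS] [xb bS]] := (KP _ aK, KP _ bK).
apply/negPn/negP => eab.
have Sm : #|S :\ y| = m.-1 by rewrite -cS (cardsD1 y S) yS.
(* Replacing y by two non-adjacent vertices a and b of K would give m + 1 independent neighbours of
   x. *)
have : #|a |: (b |: S :\ y)| <= m.
  apply: (@card_independent_le x).
    rewrite !subUset !sub1set !inE xa xb /=.
    exact: subset_trans (subsetDl _ _) Sx.
  apply/independentP => c d; rewrite !inE.
  case/or3P=> [/eqP->|/eqP->|/andP[cy cS']]; case/or3P=> [/eqP->|/eqP->|/andP[dy dS]];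
    rewrite ?eirr // ?[e b a]esym //.
  - by rewrite esym; case: (aS d dS dy).
  - by rewrite esym; case: (bS d dS dy).
  - by case: (aS c cS' cy).
  - by case: (bS c cS' cy).
  - exact: (independentP _ Si).
rewrite !cardsU1 Sm !inE (negPf ab) /=.
have /negPf-> : ~~ ((a != y) && (a \in S)).
  by apply/negP => /andP[ay aiS]; case: (aS a aiS ay); rewrite eqxx.
have /negPf-> : ~~ ((b != y) && (b \in S)).
  by apply/negP => /andP[ay aiS]; case: (bS b aiS ay); rewrite eqxx.
by lia.
Qed.

(** The size threshold is the one that [large_clique] provides. *)
Definition grand_cliques : {set {set T}} :=
  [set L | maxset clique L & r < #|L| + m * mu].

Lemma grand_cliqueW L : L \in grand_cliques -> clique L.
Proof. by rewrite inE => /andP[/maxsetp]. Qed.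

Lemma edge_grand_clique x y : e x y ->
  exists2 L, L \in grand_cliques & (x \in L) && (y \in L).
Proof.
move=> /large_clique[C [Cc xC yC Cr]].
have [L Lmax CL] := maxset_exists Cc; exists L; last by rewrite !(subsetP CL).
by rewrite inE Lmax (leq_trans Cr) // leq_add2r subset_leq_card.
Qed.

(** If L and M differ, maximality yields non-adjacent a in L and b in M. Then L and M share at most
    mu vertices, the common neighbours of a and b, while their union has at most lam + 2, all of
    them x, y or common neighbours of x and y. Two sets of size about r do not fit. *)
Lemma grand_clique_unique L M x y : L \in grand_cliques -> M \in grand_cliques ->
  x != y -> x \in L -> y \in L -> x \in M -> y \in M -> L = M.
Proof.
rewrite !inE => /andP[/maxsetP[/cliqueP Lc Lmax] Lr] /andP[/maxsetP[/cliqueP Mc Mmax] Mr].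
move=> xy xL yL xM yM; apply/eqP; rewrite -[_ == _]negbK; apply/negP => LM.
have : ~~ clique (L :|: M).
  apply: contra LM => U; rewrite -(Lmax _ U (subsetUl _ _)) eq_sym.
  by rewrite -{1}(Mmax _ U (subsetUr _ _)).
case/forall_inPn => a aU /forall_inPn[b bU]; rewrite negb_imply => /andP[ab eab].
wlog [aL bM] : a b aU bU ab eab / a \in L /\ b \in M.
  move=> W; move: aU bU; rewrite !inE => /orP[aL|aM] /orP[bL|bM].
  - by rewrite Lc in eab.
  - by apply: (W a b) => //; rewrite inE ?aL ?bM ?orbT.
  - by apply: (W b a); rewrite ?inE ?aM ?bL ?orbT // 1?eq_sym // esym.
  - by rewrite Mc in eab.
have : #|L :&: M| <= mu.
  case: G => _ [_ [_ [_ [em _]]]]; rewrite -(em _ _ ab eab).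
  apply/subset_leq_card/subsetP => c; rewrite !inE => /andP[cL cM].
  have ac : a != c by apply: contraNneq eab => ac; rewrite Mc // ac.
  have bc : b != c by apply: contraNneq eab => bc; rewrite Lc // bc.
  by rewrite Lc ?Mc.
have : #|L :|: M| <= lam.+2.
  case: G => _ [_ [_ [el _]]]; rewrite -(el _ _ (Lc _ _ xL yL xy)).
  rewrite (cardsD1 x) !inE xL (cardsD1 y) !inE eq_sym xy yL !add1n !ltnS.
  apply/subset_leq_card/subsetP => z; rewrite !inE => /and3P[zy zx /orP[zL|zM]].
    by rewrite !Lc // eq_sym.
  by rewrite !Mc // eq_sym.
have := cardsUI L M; move: Lr Mr => ? ? ? ? ?; case: mono; lia.
Qed.

Lemma card_grand_cliques2 x y : x != y ->
  #|[set L in grand_cliques | (x \in L) && (y \in L)]| = e x y.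
Proof.
move=> xy; case: (boolP (e x y)) => exy.
  have [L Ll /andP[xL yL]] := edge_grand_clique exy.
  rewrite [RHS](_ : _ = 1) // -(cards1 L); apply: eq_card => M.
  rewrite in_set1; apply/setIdP/eqP => [[Ml /andP[xM yM]]|->]; last by rewrite xL yL.
  exact: (grand_clique_unique _ _ xy).
apply: eq_card0 => L; apply/setIdP => -[/grand_cliqueW/cliqueP Lc /andP[xL yL]].
by rewrite Lc in exy.
Qed.

(** The grand cliques through x partition its k neighbours into parts of size between r - m mu and
    lam + 1. This excludes both m + 1 or more parts and m - 1 or fewer. *)
Lemma card_grand_cliques1 x : #|[set L in grand_cliques | x \in L]| = m.
Proof.
set X := [set _ in _ | _].
have XP L : L \in X -> L \in grand_cliques /\ x \in L by move=> /setIdP.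
have sumX : \sum_(L in X) #|L :\ x| = k.
  rewrite -(deg_sum G x).
  under eq_bigr do rewrite -sum1_card big_mkcond /=.
  rewrite exchange_big /=; apply: eq_bigr => y _.
  have [<-|xy] := eqVneq x y.
    by rewrite eirr big1 // => L _; rewrite !inE eqxx.
  rewrite -(card_grand_cliques2 xy) -sum1_card -big_mkcondr /=; apply: eq_bigl => L.
  by rewrite !inE eq_sym xy /= andbA.
have szl L : L \in X -> r <= #|L :\ x| + m * mu.
  by move=> /XP[+ xL]; rewrite inE (cardsD1 x) xL => /andP[].
have szu L : L \in X -> #|L :\ x| <= lam.+1.
  move=> LX; have [/grand_cliqueW Lc xL] := XP _ LX.
  have : 0 < #|L :\ x| by have := szl L LX; case: mono => *; lia.
  case/card_gt0P=> y; rewrite !inE => /andP[yx yL].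
  by have := card_clique_le Lc xL yL; rewrite eq_sym yx (cardsD1 x) xL; apply.
have lo : #|X| * r <= k + #|X| * (m * mu).
  rewrite -sumX -!sum_nat_const -big_split /=; apply: leq_sum => L; exact: szl.
have hi : k <= #|X| * lam.+1.
  by rewrite -sumX -sum_nat_const; apply: leq_sum => L; apply: szu.
apply/eqP; rewrite eqn_leq; apply/andP; split; rewrite leqNgt; apply/negP => bad.
  have : m.+1 * (r - m * mu) <= k.
    apply: leq_trans (_ : #|X| * (r - m * mu) <= _); first by rewrite leq_mul2r bad orbT.
    by rewrite mulnBr leq_subLR addnC.
  rewrite k_eq mulnBr; case: mono; lia.
have : k <= m.-1 * lam.+1.
  by apply: leq_trans hi _; rewrite leq_mul2r; lia.
exact/negP/k_large.
Qed.

End Claws.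

(** * Lines of a partial linear space with collinearity graph [e] *)

Section Lines.
Variables (T : finType) (e : rel T) (lines : {set {set T}}).
Hypothesis lines2 : forall x y, x != y ->
  #|[set L in lines | (x \in L) && (y \in L)]| = e x y.

Lemma line_clique L x y : L \in lines -> x \in L -> y \in L -> x != y -> e x y.
Proof.
move=> Ll xL yL xy; have := lines2 xy; case: (e x y) => //.
by move/eqP; rewrite cards_eq0 => /eqP/setP/(_ L); rewrite !inE Ll xL yL.
Qed.

Lemma line_unique L M x y : L \in lines -> M \in lines ->
  x != y -> x \in L -> y \in L -> x \in M -> y \in M -> L = M.
Proof.
move=> Ll Ml xy xL yL xM yM; have := lines2 xy; rewrite (line_clique Ll xL yL xy).
move=> /eqP/cards1P[N /setP EN].
have := EN L; have := EN M; rewrite !inE Ll xL yL Ml xM yM /=.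
by move=> /esym/eqP-> /esym/eqP->.
Qed.

Lemma edge_line x y : irreflexive e -> e x y ->
  exists2 L, L \in lines & (x \in L) && (y \in L).
Proof.
move=> e_irr exy; have [xy|xy] := eqVneq x y; first by rewrite xy e_irr in exy.
have := lines2 xy; rewrite exy => /eqP/cards1P[L /setP/(_ L)].
by rewrite !inE eqxx => /andP[Ll xyL]; exists L.
Qed.

End Lines.

(** * From cliques to a partial geometry *)

Section PartialGeometry.
Variables (T : finType) (e : rel T) (v k lam mu : nat).
Hypothesis G : srg e v k lam mu.
Variables r m : nat.
Hypotheses (k_eq : k = mu + r * m) (lam_eq : lam + m = mu + r).
Hypotheses (m_gt1 : 1 < m) (mu_gt0 : 0 < mu).
Variable lines : {set {set T}}.
Hypothesis lines0 : set0 \notin lines.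
Hypothesis lines1 : forall x, #|[set L in lines | x \in L]| = m.
Hypothesis lines2 : forall x y, x != y ->
  #|[set L in lines | (x \in L) && (y \in L)]| = e x y.

Let e_sym x y : e x y = e y x. Proof. by case: G => -[]. Qed.
Let eirr x : e x x = false. Proof. by case: G => -[]. Qed.

Local Open Scope ring_scope.

(* (k + m) times the column of x in (A - r) - ((k - r) / v) J, an
   eigenvector of A for -m. *)
Let u (x y : T) : int := (k + m)%:R * ((e x y)%:R - r%:R * (x == y)%:R) - mu%:R.

Lemma u_eigen x y : \sum_z (e y z)%:R * u x z + m%:R * u x y = 0.
Proof.
have -> : \sum_z (e y z)%:R * u x z = (k + m)%:R * ((common_nbrs e y x)%:R
    - r%:R * (e y x)%:R) - mu%:R * k%:R.
  have -> : mu%:R * k%:R = mu%:R * \sum_z (e y z)%:R :> int.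
    by rewrite -natr_sum (deg_sum G).
  rewrite (common_nbrs_sum G) !natr_sum.
  transitivity (\sum_z ((k + m)%:R * (e y z && e z x)%:R
      - (k + m)%:R * r%:R * ((e y z)%:R * (x == z)%:R) - mu%:R * (e y z)%:R) : int).
    by apply: eq_bigr => z _; rewrite /u -mulnb natrM [e x z]e_sym; ring.
  rewrite !big_split /= !sumrN -!mulr_sumr.
  have -> : \sum_z (e y z)%:R * (x == z)%:R = (e y x)%:R :> int.
    rewrite (bigD1 x) //= eqxx mulr1 big1 ?addr0 // => z.
    by rewrite eq_sym => /negPf->; rewrite mulr0.
  ring.
rewrite /u (srg_common G) [e y x]e_sym [y == x]eq_sym !natrD !natrM.
have lamE : lam%:R = mu%:R + r%:R - m%:R :> int by lia.
have kE : k%:R = mu%:R + r%:R * m%:R :> int by rewrite k_eq natrD natrM.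
rewrite lamE kE.
case: (eqVneq x y) => [<-|_]; rewrite ?eirr /=; first by ring.
by case: (e x y) => /=; ring.
Qed.

(** The sum of the squares over all lines is u^T N N^T u = u^T (A + m) u = 0, where N is the
    vertex-line incidence matrix. Over the integers each square then vanishes. *)
Lemma line_u_sum x L : L \in lines -> \sum_(y in L) u x y = 0.
Proof.
move=> Ll.
have S0 : \sum_(M in lines) (\sum_(y in M) u x y) ^+ 2 = 0.
  transitivity (\sum_y u x y * (\sum_z (e y z)%:R * u x z + m%:R * u x y)); last first.
    by rewrite big1 // => y _; rewrite u_eigen mulr0.
  transitivity (\sum_(M in lines) \sum_y \sum_z
      (u x y * u x z * ((y \in M) && (z \in M))%:R)).
    apply: eq_bigr => M _; rewrite expr2 big_mkcond mulr_suml /=; apply: eq_bigr => y _.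
    rewrite mulr_sumr [LHS]big_mkcond; apply: eq_bigr => z _ /=.
    by case: (y \in M); case: (z \in M); rewrite ?(mulr1, mulr0, mul0r).
  rewrite exchange_big; apply: eq_bigr => y _ /=.
  rewrite exchange_big [m%:R * _](_ : _ = \sum_z (y == z)%:R * m%:R * u x z); last first.
    rewrite (bigD1 y) //= eqxx mul1r big1 ?addr0 // => z.
    by rewrite eq_sym => /negPf->; rewrite !mul0r.
  rewrite -big_split mulr_sumr; apply: eq_bigr => z _ /=.
  rewrite -mulr_sumr -mulrA; congr (_ * _); rewrite mulrC -mulrDl; congr (_ * _).
  rewrite -natr_sum -natrM -natrD; congr (_%:R).
  have -> : (\sum_(M in lines) ((y \in M) && (z \in M)))%N
     = #|[set M in lines | (y \in M) && (z \in M)]|.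
    rewrite -sum1_card [RHS](eq_bigl (fun M => (M \in lines) && ((y \in M) && (z \in M)))).
      by rewrite big_mkcondr.
    by move=> M; rewrite inE.
  case: (eqVneq y z) => [<-|yz]; last by rewrite lines2 // addn0.
  by rewrite eirr mul1n -(lines1 y); apply: eq_card => M; rewrite !inE andbb.
have /(_ L Ll) /eqP := psumr_eq0P (fun M _ => sqr_ge0 _) S0.
by rewrite sqrf_eq0 => /eqP.
Qed.

Lemma line_u_sumE x (L : {set T}) :
  \sum_(y in L) u x y = (k + m)%:R * (#|L :&: nbhd e x|%:R - r%:R * (x \in L)%:R)
    - mu%:R * #|L|%:R.
Proof.
have -> : #|L :&: nbhd e x|%:R = \sum_(y in L) (e x y)%:R :> int.
  rewrite -natr_sum -sum1_card -big_mkcondr /=; congr (_%:R).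
  by apply: eq_bigl => y; rewrite !inE.
have -> : (x \in L)%:R = \sum_(y in L) (x == y)%:R :> int.
  rewrite -natr_sum -big_mkcondr; congr (_%:R).
  case: (boolP (x \in L)) => xL; last first.
    by rewrite big1 // => y /andP[yL /eqP xy]; rewrite xy yL in xL.
  rewrite (big_pred1 x) // => y.
  by apply/andP/eqP => [[_ /eqP]|->].
rewrite -sum1_card natr_sum !mulr_sumr -sumrB mulr_sumr -sumrB.
by apply: eq_bigr => y _; rewrite /u mulr1.
Qed.

Local Close Scope ring_scope.

(** Lines attain the Delsarte clique bound 1 + k / m: a point of L is adjacent to all the others,
    and [line_u_sum] becomes an equation for the size of L. *)
Lemma on_line_card x L : L \in lines -> x \in L -> #|L| * m = k + m.
Proof.
move=> Ll xL; have := line_u_sum x Ll; rewrite line_u_sumE xL.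
have -> : #|L| = #|L :&: nbhd e x|.+1.
  rewrite (cardsD1 x) xL add1n; congr _.+1; apply: eq_card => y; rewrite !inE.
  case: (eqVneq y x) => [->|yx] /=; first by rewrite eirr andbF.
  by case: (boolP (y \in L)) => // yL; rewrite (line_clique lines2 Ll xL yL) // eq_sym.
move: #|_| => a; rewrite mulr1 => H.
have {}H : (k + m) * a = mu * a.+1 + (k + m) * r by move: H; lia.
(* As k + m - mu = m (r + 1), the equation is r + 1 times the goal. *)
apply/eqP; rewrite -(eqn_pmul2r (ltn0Sn r)); apply/eqP.
move: H; rewrite k_eq; nia.
Qed.

Lemma off_line_card x L : L \in lines -> x \notin L -> #|L :&: nbhd e x| * m = mu.
Proof.
move=> Ll xL; have := line_u_sum x Ll; rewrite line_u_sumE (negPf xL).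
case: (set_0Vmem L) => [L0|[y yL]].
  by rewrite L0 (negPf lines0) in Ll.
have := on_line_card Ll yL; move: #|_| #|_| => a b Hb; rewrite mulr0 subr0 => H.
have {}H : (k + m) * a = mu * b by move: H; lia.
have km : 0 < k + m by lia.
apply/eqP; rewrite -(eqn_pmul2l km); apply/eqP; nia.
Qed.

End PartialGeometry.

(* An orthogonal array with m constraints is the same as m - 2 mutually
   orthogonal Latin squares: the first two constraints serve as row and column. *)
Lemma orthogonal_array_latin (T : finType) (e : rel T) (n m : nat)
    (c : 'I_m -> T -> 'I_n) : 1 < m ->
  (forall i j, i != j -> injective (fun x => (c i x, c j x))) ->
  #|T| = n * n ->
  (forall x y, e x y = (x != y) && [exists i, c i x == c i y]) ->
  exists n' r' (L : 'I_r' -> 'I_n' -> 'I_n' -> 'I_n'),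
    mols L /\ graph_iso e (latin_rel L).
Proof.
case: m c => [|[|d]] // c _ cinj cardT eE.
pose i0 : 'I_d.+2 := ord0; pose i1 : 'I_d.+2 := lift ord0 ord0.
pose i2 (s : 'I_d) : 'I_d.+2 := lift ord0 (lift ord0 s).
pose g x := (c i0 x, c i1 x).
have i01 : i0 != i1 by [].
have ginj : injective g by apply: cinj.
have [h gK hK] : bijective g.
  by apply: inj_card_bij => //; rewrite card_prod !card_ord cardT.
have h0 i j : c i0 (h (i, j)) = i by have [] := hK (i, j).
have h1 i j : c i1 (h (i, j)) = j by have [] := hK (i, j).
have ceq i j x y : i != j -> c i x = c i y -> c j x = c j y -> x = y.
  by move=> ij ci cj; apply: (cinj i j ij); rewrite ci cj.
exists n, d, (fun s i j => c (i2 s) (h (i, j))); split.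
  split=> [s|s s' ss' i j i' j' E E']; first split=> [i j j' E|j i i' E].
  - by rewrite -(h1 i j) -(h1 i j') (ceq i0 (i2 s) _ _ _ _ E) ?h0.
  - by rewrite -(h0 i j) -(h0 i' j) (ceq i1 (i2 s) _ _ _ _ E) ?h1.
  - suff E2 : h (i, j) = h (i', j').
      by split; [rewrite -(h0 i j) E2 h0|rewrite -(h1 i j) E2 h1].
    by apply: (ceq (i2 s) (i2 s')) => //; rewrite !(inj_eq lift_inj).
exists g; split=> [|x y]; first by exists h.
rewrite /latin_rel eE (inj_eq ginj) /= -/(g x) -/(g y) !gK; congr (_ && _).
apply/or3P/existsP => [[E|E|/existsP[s E]]|[i]].
- by exists i0.
- by exists i1.
- by exists (i2 s).
case: (unliftP i0 i) => [j ->|->] ; last by constructor 1.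
case: (unliftP ord0 j) => [s ->|->] E; last by constructor 2.
by constructor 3; apply/existsP; exists s.
Qed.

(** * The extremal geometries: dual Steiner systems and nets *)

Section Geometry.
Variables (T : finType) (e : rel T) (m n t : nat) (lines : {set {set T}}).
Hypothesis e_irr : irreflexive e.
Hypothesis lines1 : forall x, #|[set L in lines | x \in L]| = m.
Hypothesis lines2 : forall x y, x != y ->
  #|[set L in lines | (x \in L) && (y \in L)]| = e x y.
Hypothesis line_size : forall L, L \in lines -> #|L| = n.
Hypothesis off_line : forall L x, L \in lines -> x \notin L ->
  #|L :&: nbhd e x| = t.
Hypotheses (m_gt1 : 1 < m) (n_gt0 : 0 < n).

Let line_inh L : L \in lines -> exists x, x \in L.
Proof. by move=> /line_size Ln; apply/set0Pn; rewrite -cards_eq0 Ln -lt0n. Qed.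

Lemma card_line_cap L M : L \in lines -> M \in lines -> L != M ->
  #|M :&: L| = (M :&: L != set0).
Proof.
move=> Ll Ml LM; have [->|[x xLM]] := set_0Vmem (M :&: L).
  by rewrite cards0 eqxx.
have -> : M :&: L = [set x].
  apply/setP => y; rewrite in_set1; apply/idP/eqP => [yLM|->] //.
  apply/eqP/negPn/negP => yx; move: xLM yLM; rewrite !inE => /andP[xM xL] /andP[yM yL].
  by rewrite (line_unique lines2 Ll Ml yx) ?eqxx in LM.
by rewrite cards1 -card_gt0 cards1.
Qed.

(** A line through x meets L in at most one point, and each neighbour of x on L lies on exactly one
    line through x. *)
Lemma card_meeting_lines L x : L \in lines -> x \notin L ->
  #|[set M in lines | (x \in M) && (M :&: L != set0)]| = t.
Proof.
move=> Ll xL; rewrite -(off_line Ll xL).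
transitivity (\sum_(M in [set M in lines | x \in M]) #|M :&: L|).
  rewrite -sum1_card [LHS]big_mkcond [RHS]big_mkcond; apply: eq_bigr => M _.
  rewrite !inE; case: (boolP (M \in lines)) => //= Ml.
  case: (boolP (x \in M)) => //= xM; rewrite card_line_cap //.
  by apply: contraNneq xL => ->.
under eq_bigr do rewrite -sum1_card big_mkcond /=.
rewrite exchange_big -sum1_card [RHS]big_mkcond; apply: eq_bigr => y _ /=.
rewrite !inE; case: (boolP (y \in L)) => yL /=; last first.
  by rewrite big1 // => M _; rewrite !inE (negPf yL) andbF.
have xy : x != y by apply: contraNneq xL => ->.
transitivity (nat_of_bool (e x y)); last by case: (e x y).
rewrite -(lines2 xy) -sum1_card [LHS]big_mkcond [RHS]big_mkcond; apply: eq_bigr => M _.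
by rewrite !inE yL andbT andbA; case: (_ && _); case: (_ \in _).
Qed.

Lemma off_line_le L x : L \in lines -> x \notin L -> t <= m.
Proof.
move=> Ll xL; rewrite -(card_meeting_lines Ll xL) -(lines1 x).
by apply/subset_leq_card/subsetP => M; rewrite !inE => /and3P[-> ->].
Qed.

Lemma other_line L x : L \in lines -> x \in L ->
  exists M, [/\ M \in lines, x \in M & M != L].
Proof.
move=> Ll xL; have : 0 < #|[set M in lines | x \in M] :\ L|.
  by have := lines1 x; rewrite (cardsD1 L) inE Ll xL /=; lia.
by case/card_gt0P=> M; rewrite !inE => /and3P[ML Ml xM]; exists M.
Qed.

(** As m > 1, there are two lines through x, and they share no second point. *)
Lemma same_lines_eq x y :
  (forall L, L \in lines -> (x \in L) = (y \in L)) -> x = y.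
Proof.
move=> xy; apply/eqP/negPn/negP => nxy.
have : 0 < #|[set M in lines | x \in M]| by rewrite lines1; lia.
case/card_gt0P=> L; rewrite inE => /andP[Ll xL].
have [M [Ml xM]] := other_line Ll xL.
by rewrite (line_unique lines2 Ml Ll nxy) -?xy ?eqxx.
Qed.

(** All m lines through a point off L meet L, so any two lines meet. Dually, take the lines as
    points and the set of lines through each vertex as a block. *)
Lemma geometry_steiner : t = m ->
  exists n' m' (B : {set {set 'I_n'}}),
    2 <= m' /\ steiner_system m' B /\ graph_iso e (@steiner_rel n' B).
Proof.
move=> tm.
have meet L M : L \in lines -> M \in lines -> exists2 x, x \in L & x \in M.
  move=> Ll Ml; have [x xM] := line_inh Ml.
  case: (boolP (x \in L)) => xL; first by exists x.
  have : [set N in lines | (x \in N) && (N :&: L != set0)] == [set N in lines | x \in N].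
    rewrite eqEcard lines1 card_meeting_lines // tm leqnn andbT.
    by apply/subsetP => N; rewrite !inE => /and3P[-> ->].
  move/eqP/setP/(_ M); rewrite !inE Ml xM /= => /set0Pn[y].
  by rewrite inE => /andP[yM yL]; exists y.
pose line (i : 'I_#|lines|) : {set T} := enum_val i.
have lineP i : line i \in lines by apply: enum_valP.
have line_inj : injective line by apply: enum_val_inj.
have lineK L : L \in lines -> exists i, line i = L.
  by move=> Ll; exists (enum_rank_in Ll L); rewrite /line enum_rankK_in.
pose blk x := [set i | x \in line i].
pose B := [set blk x | x in T].
have blk_inj : injective blk.
  move=> x y /setP E; apply: same_lines_eq => L /lineK[i <-].
  by have := E i; rewrite !inE.
have blkB x : blk x \in B by apply: imset_f.
exists #|lines|, m, B; split=> //; split.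
  split=> [X /imsetP[x _ ->]|p q pq].
    rewrite -(lines1 x) -(card_imset _ line_inj); apply: eq_card => L.
    apply/imsetP/setIdP => [[i]|[Ll xL]]; first by rewrite inE => xi ->.
    by have [i iL] := lineK _ Ll; exists i; rewrite ?inE ?iL.
  have [x xp xq] := meet _ _ (lineP p) (lineP q).
  exists (blk x); split=> [|Y [/imsetP[y _ ->]]]; first by rewrite !inE blkB.
  rewrite !inE => -[yp yq]; congr blk; apply/eqP/negPn/negP => xy.
  by case/negP: pq; apply/eqP/line_inj/(line_unique lines2 _ _ xy).
pose g x : block_type B := exist _ (blk x) (blkB x).
have ginj : injective g by move=> x y [] /blk_inj.
exists g; split.
  have cB : #|B| = #|T| by rewrite card_imset.
  by apply: inj_card_bij => //; rewrite card_sig -cB; apply/eq_leq/eq_card.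
move=> x y; rewrite /steiner_rel (inj_eq ginj) /=.
have [<-|xy] := eqVneq x y; first by rewrite e_irr.
apply/set0Pn/idP => [[i]|exy].
  by rewrite !inE => /andP[xi yi]; apply: (line_clique lines2 (lineP i)).
have [L /lineK[i <-] /andP[xi yi]] := edge_line lines2 e_irr exy.
by exists i; rewrite !inE xi yi.
Qed.

(** Equality is included so that, in a net, parallelism is an equivalence relation. *)
Definition parallel (L M : {set T}) := (L == M) || (L :&: M == set0).

Lemma parallel_sym L M : parallel L M = parallel M L.
Proof. by rewrite /parallel eq_sym setIC. Qed.

Section Nets.
Hypothesis t_eq : t.+1 = m.

(** Playfair's axiom: if x is off L, then t = m - 1 of the m lines through x meet L. *)
Lemma card_parallel_at L x : L \in lines ->
  #|[set M in lines | (x \in M) && parallel M L]| = 1.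
Proof.
move=> Ll; case: (boolP (x \in L)) => xL.
  apply/eqP/cards1P; exists L; apply/setP => M; rewrite !inE.
  apply/and3P/eqP => [[Ml xM /orP[/eqP//|/eqP/setP/(_ x)]]|->].
    by rewrite !inE xM xL.
  by rewrite /parallel eqxx.
have := lines1 x; rewrite -(cardsID [set M : {set T} | M :&: L != set0]).
have -> : [set M in lines | x \in M] :&: [set M : {set T} | M :&: L != set0]
    = [set M in lines | (x \in M) && (M :&: L != set0)].
  by apply/setP => M; rewrite !inE andbA.
rewrite card_meeting_lines // -t_eq -addn1 => /addnI <-.
apply: eq_card => M; rewrite !inE negbK /parallel andbC.
case: (eqVneq M L) => [->|_] /=; first by rewrite (negPf xL) !andbF.
by case: (M \in lines); case: (x \in M); case: (_ == set0).
Qed.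

Lemma parallel_at_unique L M N x : L \in lines -> M \in lines -> N \in lines ->
  x \in M -> x \in N -> parallel M L -> parallel N L -> M = N.
Proof.
move=> Ll Ml Nl xM xN ML NL; have /eqP/cards1P[P /setP E] := card_parallel_at x Ll.
have := E M; have := E N; rewrite !inE Ml Nl xM xN ML NL.
by move=> /esym/eqP-> /esym/eqP->.
Qed.

Lemma parallel_trans L M N : L \in lines -> M \in lines -> N \in lines ->
  parallel L M -> parallel M N -> parallel L N.
Proof.
move=> Ll Ml Nl LM MN; rewrite /parallel orbC; case: eqP => //= /eqP/set0Pn[x].
rewrite inE => /andP[xL xN]; apply/eqP.
by apply: (parallel_at_unique Ml Ll Nl xL xN) => //; rewrite parallel_sym.
Qed.

(** The m lines through a fixed point o represent the parallel classes. Numbering the n lines of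
    each class makes every class a constraint of an orthogonal array. *)
Lemma geometry_latin : 0 < #|T| -> exists n' r' (L : 'I_r' -> 'I_n' -> 'I_n' -> 'I_n'),
    mols L /\ graph_iso e (latin_rel L).
Proof.
case/card_gt0P=> o _.
pose D := [set L in lines | o \in L].
pose base (i : 'I_m) := nth set0 (enum D) i.
have sD : size (enum D) = m by rewrite -cardE /D lines1.
have baseD i : base i \in D by rewrite -mem_enum mem_nth // sD.
have baseP i : base i \in lines /\ o \in base i by have /setIdP := baseD i.
have base_inj i j : base i = base j -> i = j.
  by move=> /eqP; rewrite nth_uniq ?sD ?enum_uniq // => /eqP/val_inj.
pose cls i := [set L in lines | parallel L (base i)].
have clsP i L : L \in cls i -> L \in lines /\ parallel L (base i) by move=> /setIdP.
have base_par i j : parallel (base i) (base j) -> i = j.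
  have [[_ oi] [_ oj]] := (baseP i, baseP j).
  by case/orP=> [/eqP/base_inj//|/eqP/setP/(_ o)]; rewrite !inE oi oj.
have cls_disj i j L : L \in cls i -> L \in cls j -> i = j.
  move=> /clsP[Ll Li] /clsP[_ Lj]; apply: base_par.
  have [[bi _] [bj _]] := (baseP i, baseP j).
  by apply: (parallel_trans bi Ll bj) => //; rewrite parallel_sym.
have cls_at i x : #|[set L in cls i | x \in L]| = 1.
  rewrite -(card_parallel_at x (proj1 (baseP i))); apply: eq_card => L.
  by rewrite !inE -andbA [parallel _ _ && _]andbC.
(* The line of class i through x; by [cls_at] the default is never reached. *)
pose ell i x := odflt set0 [pick L in [set L in cls i | x \in L]].
have ellP i x : ell i x \in cls i /\ x \in ell i x.
  rewrite /ell; case: pickP => [L /setIdP[]//|/eq_card0].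
  by rewrite cls_at.
have ell_eq i x L : L \in cls i -> x \in L -> ell i x = L.
  move=> Li xL; have [Ei xE] := ellP i x.
  have [[Ll Lp] [El Ep]] := (clsP _ _ Li, clsP _ _ Ei).
  by apply: (parallel_at_unique (proj1 (baseP i)) _ _ xE xL).
(* Each class partitions the points. Taking for X a line of another class gives n lines per class;
   taking all points then gives n * n points. *)
have dcount i (X : {set T}) : \sum_(L in cls i) #|L :&: X| = #|X|.
  under eq_bigr do rewrite -sum1_card big_mkcond /=.
  rewrite exchange_big -sum1_card [RHS]big_mkcond; apply: eq_bigr => x _ /=.
  case: (boolP (x \in X)) => xX; last first.
    by rewrite big1 // => L _; rewrite inE (negPf xX) andbF.
  transitivity #|[set L in cls i | x \in L]|; last by rewrite cls_at.
  rewrite -sum1_card -big_mkcondr /=; apply: eq_bigl => L.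
  by rewrite !inE xX andbT.
have cls_card i : #|cls i| = n.
  have [j ij] : exists j : 'I_m, i != j.
    have : 0 < #|[set~ i]| by rewrite cardsC1 card_ord; lia.
    by case/card_gt0P=> j; rewrite !inE eq_sym => ij; exists j.
  have [bl _] := baseP j; rewrite -(line_size bl) -(dcount i) -sum1_card.
  apply: eq_bigr => L Li; have [Ll Lp] := clsP _ _ Li.
  have Lj : ~~ parallel L (base j).
    by apply: contra ij => Lj; apply/eqP/(cls_disj _ _ L) => //; rewrite inE Ll.
  move: Lj; rewrite /parallel negb_or => /andP[neq meets].
  by rewrite (card_line_cap bl Ll) ?meets // eq_sym.
have cardT : #|T| = n * n.
  have i : 'I_m by apply: (@Ordinal m 0); lia.
  rewrite -cardsT -(dcount i) -{1}(cls_card i) -sum_nat_const; apply: eq_bigr => L.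
  by move=> /clsP[/line_size<- _]; rewrite setIT.
have ci_lt i x : index (ell i x) (enum (cls i)) < n.
  by rewrite -(cls_card i) cardE index_mem mem_enum; case: (ellP i x).
pose c i x : 'I_n := Ordinal (ci_lt i x).
have cE i x y : (c i x == c i y) = (ell i x == ell i y).
  apply/eqP/eqP => [[E]|E]; last by apply: val_inj; rewrite /= E.
  have mem z : ell i z \in enum (cls i) by rewrite mem_enum; case: (ellP i z).
  by rewrite -(nth_index set0 (mem x)) E nth_index.
apply: (orthogonal_array_latin (c := c)) => // [i j ij x y|x y].
  move=> /eqP; rewrite xpair_eqE !cE => /andP[/eqP Ei /eqP Ej]; apply/eqP/negPn/negP => xy.
  have [[Xi xi] [Xj xj]] := (ellP i x, ellP j x).
  have [[_ yi] [_ yj]] := (ellP i y, ellP j y); rewrite -Ei -Ej in yi yj.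
  have [[il _] [jl _]] := (clsP _ _ Xi, clsP _ _ Xj).
  have E := line_unique lines2 il jl xy xi yi xj yj.
  by case/negP: ij; apply/eqP/(cls_disj _ _ (ell i x)); rewrite // E.
have [<-|xy] := eqVneq x y; first by rewrite e_irr.
apply/idP/existsP => [exy|[i]].
  have [L Ll /andP[xL yL]] := edge_line lines2 e_irr exy.
  (* The class of L is that of its parallel through o. *)
  have := card_parallel_at o Ll; move/eqP/cards1P => [M /setP/(_ M)].
  rewrite !inE eqxx => /and3P[Ml oM MLp].
  have MD : M \in enum D by rewrite mem_enum inE Ml.
  have iM : index M (enum D) < m by rewrite -sD index_mem.
  have Li : L \in cls (Ordinal iM).
    by rewrite inE Ll /base /= nth_index // parallel_sym.
  by exists (Ordinal iM); rewrite cE !(ell_eq _ _ L).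
rewrite cE => /eqP E; have [Xi xi] := ellP i x; have [_ yi] := ellP i y.
by rewrite -E in yi; apply: (line_clique lines2 (proj1 (clsP _ _ Xi))).
Qed.

End Nets.
End Geometry.

(** * Numerical estimates on the parameters *)

Section Estimates.
Variables v k lam mu r m : nat.
Hypotheses (k_eq : k = mu + r * m) (lam_eq : lam + m = mu + r).
Hypothesis vmu_eq : v * mu + r * (k + m) = k * (k + m).
Hypotheses (mu_gt0 : 0 < mu) (r_gt0 : 0 < r) (m_gt1 : 1 < m) (k_lt_v : k < v).

Section PositiveDominant.
Hypothesis m_le_r : m <= r.
Variable f : nat.
Hypotheses (f_eq : f * (r + m) + k + m = v * m) (v_le : v <= f.+1 ^ 2).
Hypothesis large : (2 * k) ^ 10 <= v * r ^ 10.

Lemma vmu_le_sqr : v * mu <= k ^ 2.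
Proof.
have : k * m <= k * r by rewrite leq_mul2l m_le_r orbT.
by clear large f_eq v_le; nia.
Qed.

Lemma v_ge_pow10 : (2 * m) ^ 10 <= v.
Proof.
rewrite -(leq_pmul2r (_ : 0 < r ^ 10)) ?expn_gt0 ?r_gt0 // (leq_trans _ large) //.
by rewrite -expnMn leq_exp2r // k_eq; clear large; lia.
Qed.

(** The trace identity gives (f + 1)(r + m) <= v m; after squaring, v <= (f + 1)^2 cancels a factor
    v. *)
Lemma r_le : r ^ 2 <= v * m ^ 2.
Proof.
have v_gt0 : 0 < v by clear large; lia.
have H : f.+1 * (r + m) <= v * m by rewrite -f_eq; clear large; nia.
rewrite -(leq_pmul2l v_gt0) mulnA mulnn -expnMn.
apply: leq_trans (_ : (f.+1 * (r + m)) ^ 2 <= _); last by rewrite leq_exp2r.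
by rewrite expnMn leq_mul // leq_exp2r // leq_addr.
Qed.

(* If it fails then v ^ 3 <= 2 ^ 20 * m ^ 30, against v >= (2 * m) ^ 10; any
   constant below 32 would do in place of 16. *)
Lemma r_gt : 16 * (m * m * mu) < r.
Proof.
have v_gt0 : 0 < v by clear large; lia.
have m_gt0 : 0 < m by clear large; lia.
rewrite ltnNge; apply/negP => r_small.
(* Here (v mu)^5 <= k^10 is put into [large]. Then A2 bounds r^10 by [r_le], A3 bounds it by the
   negated claim, and combining the two in A4 eliminates mu. *)
have A1 : 2 ^ 10 * v ^ 4 * mu ^ 5 <= r ^ 10.
  rewrite -(leq_pmul2l v_gt0) (leq_trans _ large) // expnMn.
  rewrite mulnCA -mulnA leq_pmul2l ?expn_gt0 // mulnA -expnSr -expnMn.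
  by rewrite (expnM k 2 5) leq_exp2r ?vmu_le_sqr.
have A2 : 2 ^ 10 * mu ^ 5 <= v * m ^ 10.
  rewrite -(leq_pmul2l (_ : 0 < v ^ 4)) ?expn_gt0 ?v_gt0 //.
  rewrite mulnCA mulnA (leq_trans A1) // mulnA -expnSr.
  by rewrite (expnM r 2 5) (expnM m 2 5) -expnMn leq_exp2r ?r_le.
have A3 : 2 ^ 10 * v ^ 4 <= (16 * (m * m)) ^ 10 * mu ^ 5.
  rewrite -(leq_pmul2r (_ : 0 < mu ^ 5)) ?expn_gt0 ?mu_gt0 // (leq_trans A1) //.
  by rewrite -mulnA -expnD -expnMn leq_exp2r // -mulnA.
have A4 : 2 ^ 10 * 2 ^ 10 * v ^ 3 <= (16 * (m * m) * m) ^ 10.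
  rewrite -(leq_pmul2r v_gt0) -mulnA -expnSr -mulnA.
  apply: leq_trans (_ : 2 ^ 10 * ((16 * (m * m)) ^ 10 * mu ^ 5) <= _).
    by rewrite leq_pmul2l ?expn_gt0.
  rewrite mulnCA [(_ * m) ^ 10]expnMn -mulnA leq_pmul2l ?[m ^ 10 * v]mulnC //.
  by rewrite expn_gt0 !muln_gt0 m_gt0.
have : 2 ^ 10 * 2 ^ 10 * ((2 * m) ^ 10) ^ 3 <= (16 * (m * m) * m) ^ 10.
  by apply: leq_trans A4; rewrite leq_pmul2l ?muln_gt0 ?expn_gt0 // leq_exp2r ?v_ge_pow10.
rewrite expnAC -!expnMn (leq_exp2r _ _ (isT : 0 < 10)) !expnS expn0 muln1.
have : 0 < m * m * m by rewrite !muln_gt0 m_gt0.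
by clear; lia.
Qed.

(* Integrality of the rank f makes r + m divide m (m - 1) (m - t) (m - t - 1). *)
Lemma geometry_param_large (t : nat) : mu = t * m -> t.+2 <= m -> False.
Proof.
move=> mu_t tm; have t_gt0 : 0 < t by move: mu_gt0; rewrite mu_t muln_gt0 => /andP[].
pose p := r + m; pose a := m - t; pose b := m - t.+1.
have fp : f * p * t = m * m.-1 * ((r + t) * (r + t.+1)).
  have E : v * (t * m) + r * (k + m) = k * (k + m) by rewrite -mu_t.
  have kE : k = m * (r + t) by rewrite k_eq mu_t; clear large; lia.
  have kE2 : k + m = m * (r + t.+1) by rewrite kE; clear large; lia.
  have E2 : f * p * t + (k + m) * t + r * (k + m) = k * (k + m).
    have vE : v * (t * m) = (f * p + k + m) * t by rewrite /p f_eq mulnAC mulnA.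
    by rewrite -E vE; clear; lia.
  have : f * p * t + (t + r) * (k + m) = k * (k + m) by rewrite -E2; clear; lia.
  rewrite kE2 kE; have -> : m = m.-1.+1 by clear large; lia.
  by move: (m.-1) (f * p * t) => q F /=; clear; lia.
(* Modulo p, the factors r + t and r + t + 1 are -a and -b; E expresses this without subtracting. *)
have pdvd : p %| m * m.-1 * (a * b).
  have E : m * m.-1 * ((r + t) * (r + t.+1)) + m * m.-1 * (a + b) * p
      = m * m.-1 * p * p + m * m.-1 * (a * b).
    have -> : r + t = p - a by rewrite /p /a; clear large; lia.
    have -> : r + t.+1 = p - b by rewrite /p /b; clear large; lia.
    have ap : a <= p by rewrite /p /a; clear large; lia.
    have bp : b <= p by rewrite /p /b; clear large; lia.
    rewrite -[_ * (a + b) * p]mulnA -[_ * p * p]mulnA -!mulnDr; congr (_ * _).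
    have [h1 h2 h3] : [/\ (p - a + a) * (p - b) = p * (p - b),
        a * (p - b + b) = a * p & p * (p - b + b) = p * p] by rewrite !subnK.
    by move: h1 h2 h3; clear; move: (p - a) (p - b) => c d; lia.
  have d1 : p %| m * m.-1 * p * p by rewrite dvdn_mull.
  have d2 : p %| m * m.-1 * (a + b) * p by rewrite dvdn_mull.
  by rewrite -(dvdn_addr _ d1) -E (dvdn_addl _ d2) -fp mulnAC dvdn_mull.
have : p <= m ^ 4.
  apply: leq_trans (dvdn_leq _ pdvd) _.
    by rewrite !muln_gt0 /a /b; clear large; lia.
  by rewrite !expnS expn0 muln1 -mulnA !leq_mul // /a /b; clear large; lia.
move=> pm; have rm : r <= m ^ 4 by apply: leq_trans pm; rewrite leq_addr.
have k2 : k <= 2 * (m ^ 4 * m).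
  rewrite k_eq mu_t -mulnDl mulnA leq_mul2r; apply/orP; right; clear large; lia.
(* From v <= v mu <= k^2; this is 4 m^10, below the lower bound (2 m)^10. *)
have : v <= (2 * (m ^ 5)) ^ 2.
  apply: leq_trans (_ : v * mu <= _); first by rewrite leq_pmulr.
  by apply: leq_trans vmu_le_sqr _; rewrite leq_exp2r // expnSr.
apply/negP; rewrite -ltnNge; apply: leq_trans v_ge_pow10.
rewrite expnMn -expnM expnMn ltn_pmul2r ?expn_gt0 ?(ltnW m_gt1) //.
Qed.

End PositiveDominant.

Section NegativeDominant.
Hypothesis r_lt_m : r < m.
Variable g : nat.
Hypotheses (g_eq : g * (r + m) + r = v * r + k) (v_le : v <= g.+1 ^ 2).

(** If it fails, k > r m gives v > (2 r)^10. For m < 2 r this contradicts v mu <= 2 k^2. For 2 r <=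
    m, the bound mu >= m / 2 yields v^4 <= m^5, while the rank g yields m^2 <= 16 v r^2; together
    they give v^2 <= 2^10, although v > 2^10. *)
Lemma negative_dominant_bound : v * m ^ 10 < (2 * k) ^ 10.
Proof.
have v_gt0 : 0 < v by lia.
have m_gt0 : 0 < m by lia.
have mk : m <= k.
  by rewrite k_eq (leq_trans _ (leq_addl _ _)) // leq_pmull.
have vmu : v * mu <= 2 * k ^ 2.
  apply: leq_trans (_ : k * (k + m) <= _); first by rewrite -vmu_eq leq_addr.
  have : k * m <= k * k by rewrite leq_mul2l mk orbT.
  by rewrite -mulnn mulnDr; clear; lia.
(* Indeed (g + 1)(r + m) = v r + k + m, where k and m are at most v. *)
have gm : g.+1 * m <= 3 * v * r.
  apply: leq_trans (_ : g.+1 * (r + m) <= _).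
    by rewrite leq_pmul2l // leq_addl.
  have : v <= v * r by rewrite leq_pmulr.
  by move: g_eq k_lt_v mk; rewrite mulSn; clear; lia.
rewrite ltnNge; apply/negP => large.
have rv : (2 * r) ^ 10 < v.
  rewrite -(ltn_pmul2r (_ : 0 < m ^ 10)) ?expn_gt0 ?m_gt0 // (leq_trans _ large) //.
  by rewrite -expnMn ltn_exp2r // k_eq; clear large; lia.
have [m2r|r2m] := ltnP m (2 * r).
  have : 2 ^ 5 * v ^ 5 <= v * v.
    apply: leq_trans (_ : 2 ^ 5 * (2 * k ^ 2) ^ 5 <= _).
      rewrite leq_pmul2l // leq_exp2r // (leq_trans _ vmu) // leq_pmulr //.
    rewrite expnMn -expnM mulnA -expnD -[5 + 5]/10 -[2 * 5]/10 -expnMn.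
    rewrite (leq_trans large) // leq_pmul2l // ltnW // (leq_ltn_trans _ rv) //.
    by rewrite leq_exp2r // ltnW.
  apply/negP; rewrite -ltnNge mulnn; apply: leq_trans (_ : 2 ^ 5 * v ^ 2 <= _).
    by rewrite ltn_Pmull // expn_gt0 v_gt0.
  by rewrite leq_pmul2l // leq_pexp2l.
have vm : v * m <= (2 * k) ^ 2.
  have : m <= 2 * mu by move: lam_eq r2m; clear; lia.
  rewrite -(leq_pmul2l v_gt0) => H; apply: leq_trans H _.
  by rewrite expnMn mulnCA -mulnA leq_pmul2l.
have v4 : v ^ 4 <= m ^ 5.
  rewrite -(leq_pmul2l (_ : 0 < v * m ^ 5)) ?muln_gt0 ?expn_gt0 ?v_gt0 ?m_gt0 //.
  rewrite mulnAC -expnS -expnMn -[X in _ <= X]mulnA -expnD -[5 + 5]/10.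
  apply: leq_trans large; rewrite (expnM _ 2 5) leq_exp2r //.
have m2 : m ^ 2 <= 16 * (v * r ^ 2).
  rewrite -(leq_pmul2l v_gt0).
  apply: leq_trans (_ : (g.+1 * m) ^ 2 <= _).
    by rewrite expnMn leq_mul2r v_le orbT.
  apply: leq_trans (_ : (3 * v * r) ^ 2 <= _); first by rewrite leq_exp2r.
  by rewrite !expnMn -[v ^ 2]mulnn [X in _ <= X]mulnCA !mulnA !leq_mul.
have m10 : 2 ^ 10 * m ^ 10 <= 16 ^ 5 * v ^ 6.
  apply: leq_trans (_ : 2 ^ 10 * (16 * (v * r ^ 2)) ^ 5 <= _).
    by rewrite leq_pmul2l ?expn_gt0 // (expnM m 2 5) leq_exp2r.
  rewrite expnMn mulnCA leq_pmul2l ?expn_gt0 // expnMn mulnCA -expnM -[2 * 5]/10.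
  by rewrite -expnMn [v ^ 6]expnSr leq_pmul2l ?expn_gt0 ?v_gt0 // ltnW.
have : 2 ^ 10 * v ^ 8 <= 16 ^ 5 * v ^ 6.
  apply: leq_trans m10; rewrite leq_pmul2l ?expn_gt0 //.
  by rewrite (expnM v 4 2) (expnM m 5 2) leq_exp2r.
rewrite -[8]/(2 + 6) expnD mulnA leq_pmul2r ?expn_gt0 ?v_gt0 //.
rewrite (_ : 16 ^ 5 = 2 ^ 10 * 2 ^ 10); last first.
  by rewrite -expnD -[16]/(2 ^ 4) -expnM.
rewrite leq_pmul2l ?expn_gt0 //; apply/negP; rewrite -ltnNge.
apply: leq_trans (_ : v <= _); last by rewrite -mulnn leq_pmulr.
by apply: leq_ltn_trans rv; rewrite leq_exp2r // leq_pmulr.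
Qed.

End NegativeDominant.
End Estimates.

(** * Degenerate parameters *)

Section SrgFacts.
Variables (T : finType) (e : rel T) (v k lam mu : nat).
Hypothesis G : srg e v k lam mu.

Let e_sym x y : e x y = e y x. Proof. by case: G => -[]. Qed.
Let e_irr x : e x x = false. Proof. by case: G => -[]. Qed.
Let deg x : #|nbhd e x| = k. Proof. by case: G => _ [_ []]. Qed.

Lemma srg_v_gt : k.+1 < v.
Proof.
case: G => _ [<- [_ [_ [_ [_ [x [y [xy exy]]]]]]]].
rewrite -[#|T|]cardsT (cardsD1 x [set: T]) in_setT (cardsD1 y) !inE eq_sym xy.
rewrite !add1n !ltnS -(deg x).
apply/subset_leq_card/subsetP => z; rewrite !inE andbT => exz.
by apply/andP; split; apply: contraTneq exz => ->; rewrite ?e_irr.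
Qed.

(** For mu = 0 a vertex and its neighbours would form a connected component, missing any
    non-neighbour. *)
Lemma srg_mu_gt0 : connected_graph e -> 0 < mu.
Proof.
move=> conn; rewrite lt0n; apply/negP => /eqP mu0.
case: G => _ [_ [_ [_ [em [_ [x [y [xy exy]]]]]]]].
have cl : closed e [pred z | (z == x) || e x z].
  have W a b : e a b -> (a == x) || e x a -> (b == x) || e x b.
    move=> eab /orP[/eqP<-|exa]; first by rewrite eab orbT.
    rewrite eq_sym orbC; apply/negPn/negP; rewrite negb_or => /andP[nxb xb].
    have /eqP := em _ _ xb nxb; rewrite mu0 cards_eq0 => /eqP/setP/(_ a).
    by rewrite !inE exa e_sym eab.
  by move=> a b eab; apply/idP/idP; rewrite !inE; apply: W; rewrite // e_sym.
have := closed_connect cl (conn x y); rewrite !inE eqxx eq_sym (negPf xy).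
by rewrite (negPf exy).
Qed.

Lemma srg_mu_le_k : mu <= k.
Proof.
case: G => _ [_ [_ [_ [em [_ [x [y [xy exy]]]]]]]].
by rewrite -(em _ _ xy exy) -(deg x) subset_leq_card // subsetIl.
Qed.

(** Non-adjacent vertices then have equal neighbourhoods, so the fibres of [nbhd e], all of size v -
    k, are the parts. *)
Lemma srg_mu_eq_k : mu = k -> exists t m, graph_iso e (@cmp_rel t m).
Proof.
move=> muk; have cardT : #|T| = v by case: G => _ [].
pose N := nbhd e.
have NE x y : e x y = (N x != N y).
  case: G => _ [_ [_ [_ [em _]]]].
  have [<-|xy] := eqVneq x y; first by rewrite e_irr eqxx.
  case: (boolP (e x y)) => exy; apply/esym.
    by apply: contraTneq exy => /setP/(_ y); rewrite !inE e_irr => ->.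
  apply/negbTE; rewrite negbK eqEcard !deg leqnn andbT; apply/setIidPl/eqP.
  by rewrite eqEcard subsetIl deg -muk -(em _ _ xy exy) /=.
pose X := [set N x | x in T].
have cls x : #|[set y | N y == N x]| = v - k.
  rewrite -cardT -(cardsC (N x)) deg addKn; apply: eq_card => y.
  by rewrite !inE NE eq_sym negbK.
have cT : #|T| = #|X| * (v - k).
  transitivity (\sum_(x : T) 1); first by rewrite sum1_card.
  rewrite (partition_big N [in X]) /=; last by move=> x _; rewrite imset_f.
  rewrite -sum_nat_const.
  apply: eq_bigr => _ /imsetP[x _ ->]; rewrite -(cls x) -sum1_card.
  by apply: eq_bigl => y; rewrite !inE.
have i1 x : index (N x) (enum X) < #|X| by rewrite cardE index_mem mem_enum imset_f.
have i2 x : index x (enum [set y | N y == N x]) < v - k.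
  by rewrite -(cls x) cardE index_mem mem_enum inE.
pose g x : 'I_#|X| * 'I_(v - k) := (Ordinal (i1 x), Ordinal (i2 x)).
have g1 x y : ((g x).1 == (g y).1) = (N x == N y).
  apply/eqP/eqP => [[E]|E]; last by apply: val_inj; rewrite /= E.
  have mem z : N z \in enum X by rewrite mem_enum imset_f.
  by rewrite -(nth_index set0 (mem x)) E nth_index.
have ginj : injective g.
  move=> x y gxy; have /eqP Nxy : N x == N y by rewrite -g1 gxy.
  have := congr1 (fun p => val p.2) gxy; rewrite /= Nxy => E.
  have mem z : N z = N y -> z \in enum [set w | N w == N y].
    by move=> Nz; rewrite mem_enum inE Nz.
  by rewrite -(nth_index x (mem x Nxy)) E nth_index // mem.
exists #|X|, (v - k), g; split; last by move=> x y; rewrite /cmp_rel g1 NE.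
by apply: inj_card_bij => //; rewrite card_prod !card_ord cT.
Qed.

Lemma srg_vmu_nat (r m : nat) : k = mu + r * m -> lam + m = mu + r ->
  v * mu + r * (k + m) = k * (k + m).
Proof.
move=> k_eq lam_eq; have := srg_count G.
have : (lam + m) * k = (mu + r) * k by rewrite lam_eq.
move: k_eq; clear; lia.
Qed.

(** If m = 1, then k = mu + r and [srg_vmu_nat] gives v = k + 1, so the graph would be complete. *)
Lemma srg_m_gt1 (r m : nat) : k = mu + r * m -> lam + m = mu + r ->
  0 < mu -> mu < k -> 0 < r /\ 1 < m.
Proof.
move=> k_eq lam_eq mu0 muk.
have rm : 0 < r * m by lia.
have [r0 m0] : 0 < r /\ 0 < m by apply/andP; rewrite -muln_gt0.
split=> //; rewrite ltn_neqAle m0 andbT; apply/eqP => m1.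
have := srg_vmu_nat k_eq lam_eq; rewrite -m1 addn1.
have -> : k = mu + r by rewrite k_eq -m1 muln1.
have : mu * k.+2 <= mu * v by rewrite leq_mul2l srg_v_gt orbT.
have -> : k = mu + r by rewrite k_eq -m1 muln1.
move: mu0; clear; lia.
Qed.

End SrgFacts.

Lemma perfect_square_quotient (a b D : nat) :
  0 < a -> a ^ 2 * D = b ^ 2 -> exists c, D = c ^ 2.
Proof.
move=> a0 E; have : a ^ 2 %| b ^ 2 by rewrite -E dvdn_mulr.
rewrite dvdn_pexp2r // => /dvdnP[c bE]; exists c; apply/eqP.
by rewrite -(@eqn_pmul2l (a ^ 2)) ?expn_gt0 ?a0 // E bE expnMn mulnC.
Qed.

(** * Integrality of the eigenvalues and the integral case *)

Section Main.
Variables (T : finType) (e : rel T) (v k lam mu : nat).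
Hypothesis G : srg e v k lam mu.
Hypotheses (mu_gt0 : 0 < mu) (mu_lt_k : mu < k).

(** The hypothesis says c^2 = (lam - mu)^2 + 4 (k - mu), the discriminant of the quadratic with
    roots r and -m. Since c and lam + mu have the same parity, the halves in the quadratic formula
    are exact. *)
Lemma discriminant_square (c : nat) :
  c ^ 2 + 4 * mu + 2 * lam * mu = lam ^ 2 + mu ^ 2 + 4 * k ->
  exists r m : nat, k = mu + r * m /\ lam + m = mu + r.
Proof.
move=> cE.
have [c1 c2] : mu < c + lam /\ lam < c + mu by split; nia.
have par : ~~ odd (c + lam + mu).
  have := congr1 odd cE; rewrite -!mulnn !oddD !oddM /=.
  by case: (odd c); case: (odd lam); case: (odd mu); case: (odd k).
pose r := (c + lam - mu)./2; pose m := (c + mu - lam)./2.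
have rE : 2 * r + mu = c + lam by rewrite /r; lia.
have mE : 2 * m + lam = c + mu by rewrite /m; lia.
exists r, m; split; last by lia.
have : (2 * r + mu) * (2 * m + lam) = (c + lam) * (c + mu) by rewrite rE mE.
have : (2 * r + mu) * mu = (c + lam) * mu by rewrite rE.
have : (2 * m + lam) * lam = (c + mu) * lam by rewrite mE.
have : (2 * m + lam) * mu = (c + mu) * mu by rewrite mE.
have : (2 * r + mu) * lam = (c + lam) * lam by rewrite rE.
move: cE; rewrite -!mulnn; clear; lia.
Qed.

Local Open Scope ring_scope.

Let gt0_of_sum_prod (x y : algC) :
  x \is Num.real -> 0 < x * y -> 0 < x + y -> 0 < x.
Proof.
move=> xr xy0 s0; rewrite real_ltNge ?real0 //; apply/negP.
rewrite le_eqVlt => /orP[/eqP x0|xn].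
  by rewrite x0 mul0r ltxx in xy0.
by rewrite nmulr_rgt0 // in xy0; have := lt_trans s0 (ltrD xn xy0); rewrite addr0 ltxx.
Qed.

Lemma discriminant_eigenvalues (D : nat) :
  (D + 4 * mu + 2 * lam * mu = lam ^ 2 + mu ^ 2 + 4 * k)%N ->
  exists r m : algC, [/\ 0 < r, 0 < m, k%:R = mu%:R + r * m, lam%:R + m = mu%:R + r
    & (r + m) ^+ 2 = D%:R].
Proof.
move=> DN.
have DE : D%:R + 4 * mu%:R + 2 * lam%:R * mu%:R =
    lam%:R ^+ 2 + mu%:R ^+ 2 + 4 * k%:R :> algC.
  by rewrite -!natrX -!natrM -!natrD DN.
pose q : algC := sqrtC D%:R.
have qq : q ^+ 2 = D%:R by rewrite sqrtCK.
have q_real : q \is Num.real by rewrite ger0_real // sqrtC_ge0 ler0n.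
pose r : algC := (lam%:R - mu%:R + q) / 2; pose m : algC := (mu%:R - lam%:R + q) / 2.
have rmE : r * m = k%:R - mu%:R.
  have -> : r * m = (q ^+ 2 - (lam%:R - mu%:R) ^+ 2) / 4 by rewrite /r /m; field.
  have -> : q ^+ 2 = lam%:R ^+ 2 + mu%:R ^+ 2 + 4 * k%:R - 4 * mu%:R
      - 2 * lam%:R * mu%:R.
    by rewrite qq -DE; ring.
  by field.
have rm_sum : r + m = q by rewrite /r /m; field.
have rm_gt0 : 0 < r * m by rewrite rmE subr_gt0 ltr_nat.
have q_gt0 : 0 < q.
  have q2 : 0 < q ^+ 2.
    have -> : q ^+ 2 = (lam%:R - mu%:R) ^+ 2 + 4 * (r * m) by rewrite /r /m; field.
    apply: ltr_wpDl; last by rewrite mulr_gt0 ?ltr0n.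
    by rewrite -realEsqr realB ?realn.
  rewrite lt_def sqrtC_ge0 ler0n andbT; apply: contraTneq q2 => ->.
  by rewrite expr0n ltxx.
have half_real (x y : nat) : (x%:R - y%:R + q) / 2 \is Num.real.
  apply: realM; first by rewrite realD ?realB ?realn.
  by rewrite realV realn.
exists r, m; split.
- by apply: gt0_of_sum_prod (half_real lam mu) rm_gt0 _; rewrite rm_sum.
- have mr_gt0 : 0 < m * r by rewrite mulrC.
  by apply: gt0_of_sum_prod (half_real mu lam) mr_gt0 _; rewrite addrC rm_sum.
- by rewrite rmE; ring.
- by rewrite /r /m; field.
- by rewrite rm_sum.
Qed.

(** The trace identity makes (2 f - (v - 1))(r + m) an integer, and (r + m)^2 = D. If 2 f != v - 1,
    then D is a perfect square. Otherwise (v - 1)(mu - lam) = 2 k, and k < v - 1 forces mu - lam =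
    1: a conference graph. *)
Lemma eigenvalues_integral :
  (exists r m : nat, k = mu + r * m /\ lam + m = mu + r)%N \/
  [/\ v = k.*2.+1, k = mu.*2 & lam.+1 = mu].
Proof.
have [D DE] : exists D, (D + 4 * mu + 2 * lam * mu = lam ^ 2 + mu ^ 2 + 4 * k)%N.
  (* No subtraction truncates, because 2 lam mu <= lam^2 + mu^2 and mu < k. *)
  exists (lam ^ 2 + mu ^ 2 + 4 * k - 4 * mu - 2 * lam * mu)%N.
  by have [le2 _] := nat_Cauchy lam mu; lia.
have [r [m [r0 m0 kE lamE rmD]]] := discriminant_eigenvalues DE.
have lamE' : lam%:R = mu%:R + r - m :> algC by rewrite -lamE addrK.
(* The value m = 1, outside the scope of [rank_pos_eigenspace], gives the integer r = k - mu. *)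
have [m1|m1] := eqVneq m 1.
  left; exists (k - mu)%N, 1%N; rewrite muln1 subnKC ?(ltnW mu_lt_k) //; split=> //.
  apply/eqP; rewrite -(eqr_nat algC) natrD lamE' kE m1; apply/eqP; ring.
have [f [fE _]] := rank_pos_eigenspace G m0 kE lamE m1.
have key : (2 * f%:R - (v%:R - 1)) * (r + m) =
    (v%:R - 1) * (mu%:R - lam%:R) - 2 * k%:R :> algC.
  have -> : (2 * f%:R - (v%:R - 1)) * (r + m) =
      2 * (f%:R * (r + m)) - (v%:R - 1) * (r + m) by ring.
  by rewrite fE lamE'; ring.
pose a : int := 2 * f%:Z - (v%:Z - 1).
pose b : int := (v%:Z - 1) * (mu%:Z - lam%:Z) - 2 * k%:Z.
have abD : (`|a| ^ 2 * D = `|b| ^ 2)%N.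
  have H : a ^+ 2 * D%:Z = b ^+ 2.
    apply: (@intr_inj algC); rewrite rmorphM !rmorphXn /=.
    have -> : (a%:~R : algC) = 2 * f%:R - (v%:R - 1).
      by rewrite /a !rmorphB rmorphM /= !pmulrn.
    have -> : (b%:~R : algC) = (v%:R - 1) * (mu%:R - lam%:R) - 2 * k%:R.
      by rewrite /b !rmorphB !rmorphM !rmorphB /= !pmulrn.
    by rewrite -key exprMn rmD pmulrn.
  by have := congr1 absz H; rewrite abszM !abszX.
have [a0|a0] := eqVneq a 0; last first.
  have a_gt0 : (0 < `|a|)%N by rewrite absz_gt0.
  left; have [c cE] := perfect_square_quotient a_gt0 abD.
  by apply: (@discriminant_square c); rewrite -cE.
right; have b0 : b = 0.
  by move: abD; rewrite a0 absz0 => /esym/eqP; rewrite expn_eq0 andbT absz_eq0 => /eqP.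
have vk := srg_v_gt G.
have lam1 : lam.+1 = mu by move: b0; rewrite /b; nia.
have vE : v = k.*2.+1 by move: b0; rewrite /b -lam1; nia.
split=> //; have := srg_count G; rewrite vE -{}lam1 => E.
apply/eqP; rewrite -(@eqn_pmul2l k); last by lia.
by apply/eqP; move: E; clear; lia.
Qed.
Local Close Scope ring_scope.

Section Integral.
Variables r m : nat.
Hypotheses (k_eq : k = mu + r * m) (lam_eq : lam + m = mu + r).

Let rm_gt : 0 < r /\ 1 < m. Proof. exact: (srg_m_gt1 G). Qed.
Let r_gt0 : 0 < r. Proof. by case: rm_gt. Qed.
Let m_gt1 : 1 < m. Proof. by case: rm_gt. Qed.
Let m_gt0 : 0 < m. Proof. exact: ltnW. Qed.
Let vmu_eq := srg_vmu_nat G k_eq lam_eq.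
Let k_lt_v : k < v. Proof. exact: ltnW (srg_v_gt G). Qed.

Lemma eigenvalue_natr : [/\ 0 < r%:R :> algC, 0 < m%:R :> algC,
  k%:R = mu%:R + r%:R * m%:R :> algC & lam%:R + m%:R = mu%:R + r%:R :> algC]%R.
Proof. by rewrite !ltr0n -natrM -!natrD lam_eq k_eq. Qed.

Lemma rank_pos_nat : exists f, f * (r + m) + k + m = v * m /\ v <= f.+1 ^ 2.
Proof.
have [r0 m0 kE lamE] := eigenvalue_natr.
have [|f [fE vf]] := rank_pos_eigenspace G m0 kE lamE.
  by rewrite pnatr_eq1 gtn_eqF.
exists f; split=> //; apply/eqP; rewrite -(eqr_nat algC) !natrD !natrM natrD.
by apply/eqP; rewrite fE; ring.
Qed.

Lemma rank_neg_nat : exists g, g * (r + m) + r = v * r + k /\ v <= g.+1 ^ 2.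
Proof.
have [r0 m0 kE lamE] := eigenvalue_natr.
have [g [gE vg]] := rank_neg_eigenspace G r0 kE lamE.
exists g; split=> //; apply/eqP; rewrite -(eqr_nat algC) !natrD !natrM natrD.
by apply/eqP; rewrite gE; ring.
Qed.

(** Always t <= m, and exceptionality removes t = m (Steiner) and t = m - 1 (Latin square). *)
Lemma geometry_exceptional (lines : {set {set T}}) : set0 \notin lines ->
  (forall x, #|[set L in lines | x \in L]| = m) ->
  (forall x y, x != y -> #|[set L in lines | (x \in L) && (y \in L)]| = e x y) ->
  exceptional e -> exists2 t, mu = t * m & t.+1 < m.
Proof.
move=> l0 l1 l2 [_ nolatin nosteiner].
have e_irr : irreflexive e by case: G => -[].
have offm L x : L \in lines -> x \notin L -> #|L :&: nbhd e x| * m = mu.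
  exact: (off_line_card G k_eq lam_eq m_gt1 mu_gt0 l0 l1 l2).
(* Two non-adjacent vertices share no line. This pair serves to define t. *)
have [L0 [x0 [L0l x0L0]]] : exists L x, L \in lines /\ x \notin L.
  case: G => _ [_ [_ [_ [_ [_ [x [y [xy exy]]]]]]]].
  have : 0 < #|[set L in lines | y \in L]| by rewrite l1.
  case/card_gt0P=> L; rewrite inE => /andP[Ll yL]; exists L, x; split=> //.
  by apply: contra exy => xL; apply: (line_clique l2 Ll xL yL xy).
pose t := #|L0 :&: nbhd e x0|.
have mu_t : mu = t * m by rewrite offm.
have off L x : L \in lines -> x \notin L -> #|L :&: nbhd e x| = t.
  move=> Ll xL; apply/eqP; rewrite -(eqn_pmul2r m_gt0) -mu_t; apply/eqP.
  exact: offm.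
have size L : L \in lines -> #|L| = r + t.+1.
  move=> Ll; have [E|[x xL]] := set_0Vmem L; first by rewrite E (negPf l0) in Ll.
  apply/eqP; rewrite -(eqn_pmul2r m_gt0); apply/eqP.
  rewrite (on_line_card G k_eq lam_eq m_gt1 mu_gt0 l0 l1 l2 Ll xL) k_eq mu_t.
  by clear; lia.
have n_gt0 : 0 < r + t.+1 by rewrite addnS.
have T_gt0 : 0 < #|T| by apply/card_gt0P; exists x0.
exists t => //; rewrite ltn_neqAle; apply/andP; split.
  apply/eqP => t1; apply: nolatin.
  exact: (geometry_latin e_irr l1 l2 size off m_gt1 n_gt0 t1 T_gt0).
rewrite ltn_neqAle (off_line_le l1 l2 off L0l x0L0) andbT.
apply/eqP => tm; apply: nosteiner.
exact: (geometry_steiner e_irr l1 l2 size off m_gt1 n_gt0 tm).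
Qed.

Lemma eigenvalue_bound : exceptional e -> v * maxn r m ^ 10 < (2 * k) ^ 10.
Proof.
move=> exc; have [m_le_r|r_lt_m] := leqP m r; last first.
  have [g [gE vg]] := rank_neg_nat.
  exact: (negative_dominant_bound k_eq lam_eq vmu_eq mu_gt0 r_gt0 m_gt1 k_lt_v
            r_lt_m gE vg).
have [f [fE vf]] := rank_pos_nat.
rewrite ltnNge; apply/negP => large.
have rbig := ltnW (r_gt k_eq lam_eq vmu_eq mu_gt0 r_gt0 m_gt1 k_lt_v m_le_r
                    fE vf large).
have l1 := card_grand_cliques1 G k_eq lam_eq m_gt1 mu_gt0 rbig.
have l2 := card_grand_cliques2 G k_eq lam_eq m_gt1 mu_gt0 rbig.
have l0 : set0 \notin grand_cliques e mu r m.
  rewrite inE cards0 add0n negb_and -leqNgt; apply/orP; right.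
  by apply: leq_trans rbig; rewrite -mulnA mulnA leq_pmull // muln_gt0 m_gt0.
have [t mu_t tm] := geometry_exceptional l0 l1 l2 exc.
exact: (geometry_param_large k_eq lam_eq vmu_eq mu_gt0 r_gt0 m_gt1 k_lt_v m_le_r
          fE vf large mu_t tm).
Qed.

End Integral.
End Main.

(** * The bound on k / Lambda *)

Local Open Scope ring_scope.

Theorem theorem0p4 (T : finType) (e : rel T) (v k lam mu : nat)
  (s : seq algC) :
  srg e v k lam mu -> connected_graph e -> exceptional e ->
  char_poly (adj_mx e) = \prod_(x <- s) ('X - x%:P) ->
  10.-root (v%:R : algC) / 2 < k%:R / Lambda s k.
Proof.
move=> G conn exc chs.
have mu_gt0 := srg_mu_gt0 G conn.
have mu_lt_k : (mu < k)%N.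
  rewrite ltn_neqAle (srg_mu_le_k G) andbT; apply/eqP => /(srg_mu_eq_k G).
  by case: exc.
have v_gt1 : (1 < v)%N by apply: leq_trans (srg_v_gt G); rewrite ltnS.
pose w : algC := 10.-root v%:R.
have w_ge0 : 0 <= w by rewrite rootC_ge0 ?ler0n.
have w10 : w ^+ 10 = v%:R by rewrite rootCK.
(* An upper bound M of Lambda suffices, as w / 2 < k / M <= k / Lambda. *)
suff [M LM wM] : exists2 M : algC, 0 < Lambda s k <= M & w * M < 2 * k%:R.
  case/andP: LM => L0 LM; rewrite ltr_pdivlMr ?ltr0n // mulrAC ltr_pdivrMr ?ltr0n //.
  by rewrite mulrC [_ * 2]mulrC (le_lt_trans _ wM) // mulrC ler_wpM2l.
have [[r [m [k_eq lam_eq]]]|[vE kE lamE]] := eigenvalues_integral G mu_gt0 mu_lt_k.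
  have [r0 m0 kR lamR] := eigenvalue_natr G mu_gt0 mu_lt_k k_eq lam_eq.
  exists (maxn r m)%:R.
    by apply: (Lambda_bounds G mu_gt0 r0 m0 kR lamR chs) => //;
      rewrite ler_nat ?leq_maxl ?leq_maxr.
  rewrite -(@ltr_pXn2r _ 10) ?nnegrE ?mulr_ge0 ?ler0n //.
  rewrite exprMn w10 -natrM -!natrX -natrM ltr_nat.
  exact: (eigenvalue_bound G mu_gt0 mu_lt_k k_eq lam_eq exc).
(* Conference graph: v = 4 mu + 1 >= 5, and the eigenvalues other than k are (-1 + q) / 2 and (-1 -
   q) / 2. *)
pose q : algC := sqrtC v%:R.
have qq : q ^+ 2 = v%:R by rewrite sqrtCK.
have q_gt2 : 2 < q.
  have q_ge0 : 0 <= q by rewrite sqrtC_ge0 ler0n.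
  rewrite -(@ltr_pXn2r _ 2) ?nnegrE ?ler0n // qq -natrX ltr_nat vE kE; lia.
have w_le_q : w <= q.
  have q_ge0 : 0 <= q by rewrite sqrtC_ge0 ler0n.
  have w_ge1 : 1 <= w by rewrite rootC_ge1 // ler1n ltnW.
  rewrite -(@ler_pXn2r _ 2) ?nnegrE // qq -w10.
  by rewrite ler_weXn2l.
pose r : algC := (q - 1) / 2; pose m : algC := (q + 1) / 2.
have q1 : 1 < q by apply: lt_trans q_gt2; rewrite ltr1n.
have r_gt0 : 0 < r by rewrite divr_gt0 ?ltr0n ?subr_gt0.
have rm : m = r + 1 by rewrite /m /r; field.
have vR : v%:R = 4 * mu%:R + 1 :> algC.
  by rewrite -natrM natr1 vE kE; congr (_%:R); lia.
have kR : k%:R = 2 * mu%:R :> algC by rewrite -natrM kE -mul2n.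
have rmE : k%:R = mu%:R + r * m.
  have -> : r * m = (q ^+ 2 - 1) / 4 by rewrite /r /m; field.
  by rewrite qq vR kR; field.
have lamR : lam%:R + m = mu%:R + r by rewrite rm -lamE -natr1; ring.
have m_gt0 : 0 < m by rewrite rm addr_gt0.
exists m.
  by apply: (Lambda_bounds G mu_gt0 r_gt0 m_gt0 rmE lamR chs) => //; rewrite rm lerDl.
(* Here 2 k = v - 1 = (q - 1)(q + 1), and w <= q < 2 (q - 1) because q > 2. *)
have -> : 2 * k%:R = (q - 1) * 2 * m.
  have -> : (q - 1) * 2 * m = q ^+ 2 - 1 by rewrite /m; field.
  by rewrite qq vR kR; ring.
rewrite ltr_pM2r // (le_lt_trans w_le_q) //.
have -> : (q - 1) * 2 = q + (q - 2) by ring.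
by rewrite ltrDl subr_gt0.
Qed.
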